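(* Let $\alpha\in\mathbb{R}^d$ be an irrational vector. A Riemann measurable set $S$ in $\mathbb{R}^d$ is a bounded remainder set (with respect to $\alpha$) if and only if it is equidecomposable to some parallelepiped spanned by vectors in $\mathbb{Z}\alpha+\mathbb{Z}^d$, using translations by vectors belonging to $\mathbb{Z}\alpha+\mathbb{Z}^d$.
   Context: A vector $\alpha = (\alpha_1,\dots,\alpha_d) \in \mathbb{R}^d$ is called irrational if $1, \alpha_1, \ldots, \alpha_d$ are linearly independent over $\mathbb{Q}$. We write $\mathbb{Z}\alpha+\mathbb{Z}^d = \{ n\alpha + m : n \in \mathbb{Z}, m \in \mathbb{Z}^d\}$ and $\mathbb{T}^d = \mathbb{R}^d/\mathbb{Z}^d$. For a bounded measurable set $S \subset \mathbb{R}^d$ let $\chi_S(x) = \sum_{k \in \mathbb{Z}^d} \mathbf{1}_S(x+k)$, where $\mathbf{1}_S$ is the indicator function of $S$; this is a $\mathbb{Z}^d$-periodic function regarded as a function on $\mathbb{T}^d$. A bounded measurable set $S \subset \mathbb{R}^d$ is a bounded remainder set (BRS) with respect to $\alpha$ if there is a constant $C = C(S,\alpha)$ such that for every $n \geq 1$ and almost every $x \in \mathbb{T}^d$, $\left| \sum_{k=0}^{n-1} \chi_S(x+k\alpha) - n \operatorname{mes} S \right| \leq C$, where $\operatorname{mes}$ is Lebesgue measure. A bounded set in $\mathbb{R}^d$ is Riemann measurable if its boundary has Lebesgue measure zero. A parallelepiped spanned by vectors $v_1,\dots,v_d$ is a set of the form $\{ \sum_{k=1}^d t_k v_k : 0 \leq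 t_k < 1 \}$, where $v_1,\dots,v_d$ are linearly independent vectors in $\mathbb{R}^d$. Two Riemann measurable sets $S, S'$ are equidecomposable using translations by vectors in $\mathbb{Z}\alpha+\mathbb{Z}^d$ if $S$ can be partitioned into finitely many Riemann measurable subsets $S_1,\dots,S_N$ and there are vectors $\gamma_1,\dots,\gamma_N \in \mathbb{Z}\alpha+\mathbb{Z}^d$ such that the sets $S_j+\gamma_j$ form, up to measure zero, a partition of $S'$.
   Formalization: The set S is assumed to have positive Lebesgue measure: a Riemann measurable null set (e.g. the empty set) is trivially a bounded remainder set but is never equidecomposable to a parallelepiped, which has positive measure. *)

(* Defs.v *)
(* MathComp-Analysis: the reals are an arbitrary [R : realType] and R^n is
   ['rV[R]_n] with its sup-norm topology. *)
From HB Require Import structures.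
From mathcomp Require Import all_boot all_order all_algebra.
From mathcomp Require Import all_classical all_reals all_analysis.
Set Implicit Arguments.
Unset Strict Implicit.
Unset Printing Implicit Defensive.
Import Order.TTheory GRing.Theory Num.Theory.
Import numFieldNormedType.Exports.
Local Open Scope classical_set_scope.
Local Open Scope ring_scope.

Definition box (R : realType) (d : nat) (B : 'rV[R]_d * 'rV[R]_d) :
    set 'rV[R]_d :=
  [set x | forall i, B.1 0 i < x 0 i <= B.2 0 i].

Definition box_volume (R : realType) (d : nat) (B : 'rV[R]_d * 'rV[R]_d) : R :=
  \prod_(i < d) Num.max 0 (B.2 0 i - B.1 0 i).

(* Lebesgue outer measure. The dimension is a successor because in dimension 0
   no box is empty, so that the empty set would not get measure 0. *)
Definition lebesgue_outer (R : realType) (d : nat) (A : set 'rV[R]_d.+1) :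
    \bar R :=
  ereal_inf [set (\sum_(0 <= k <oo) (box_volume (B k))%:E)%E
            | B in [set B : nat -> 'rV[R]_d.+1 * 'rV[R]_d.+1 |
                     A `<=` \bigcup_k box (B k)]].

Section lebesgue_outer_measure.
Context (R : realType) (d : nat).
Local Open Scope ereal_scope.
Local Notation mu := (@lebesgue_outer R d).
Let vol (B : 'rV[R]_d.+1 * 'rV[R]_d.+1) : \bar R := (box_volume B)%:E.

Let vol_ge0 B : 0 <= vol B.
Proof. by rewrite lee_fin; apply: prodr_ge0 => i _; rewrite le_max lexx. Qed.

Let mu_ge0 A : 0 <= mu A.
Proof.
apply: le_ereal_inf_tmp => _ [B _ <-].
by apply: nneseries_ge0 => k _ _; exact: vol_ge0.
Qed.

Let mu0 : mu set0 = 0.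
Proof.
apply/eqP; rewrite eq_le mu_ge0 andbT; apply: ereal_inf_lbound.
exists (fun=> (0%R, 0%R)) => //; apply: eseries0 => k _ _ /=.
by rewrite /box_volume big_ord_recl /= subrr maxxx mul0r.
Qed.

Let mu_le : {homo mu : A B / A `<=` B >-> A <= B}.
Proof.
move=> A B AB; apply: ereal_inf_le_tmp => _ [C BC <-].
by exists C => //; exact: subset_trans AB BC.
Qed.

Let mu_sigma_subadditive : sigma_subadditive mu.
Proof.
move=> A; have [[i ioo]|] := pselect (exists i, mu (A i) = +oo).
  rewrite (eseries_pinfty _ _ ioo) ?leey// => n _.
  by rewrite -ltNye (lt_le_trans _ (mu_ge0 _)).
rewrite -forallNE => Aoo.
apply/lee_addgt0Pr => _/posnumP[e].
rewrite (le_trans _ (epsilon_trick _ _ _))//.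
pose P n (B : nat -> 'rV[R]_d.+1 * 'rV[R]_d.+1) :=
  A n `<=` \bigcup_k box (B k) /\
  \sum_(k <oo) vol (B k) <= mu (A n) + (e%:num / (2 ^ n.+1)%:R)%:E.
have [G PG] : {G & forall n, P n (G n)}.
  apply: (@choice _ _ P) => n.
  have en1 : (0 < e%:num / (2 ^ n.+1)%:R)%R by [].
  have Afin : mu (A n) \is a fin_num.
    by rewrite ge0_fin_numE// ltey; exact/eqP/Aoo.
  have [_ [B AB <-] Blt] := lb_ereal_inf_adherent en1 Afin.
  by exists B; split => //; exact/ltW.
apply: (@le_trans _ _ (\esum_(i in setT) (vol \o uncurry G) i)).
  apply: ereal_inf_lbound => /=.
  have /card_esym/ppcard_eqP[f] := card_nat2.
  exists (uncurry G \o f) => /=.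
    move=> t [i _] /(PG i).1[j _ Bijt]; exists (f^-1%FUN (i, j)) => //=.
    by rewrite invK ?inE.
  rewrite -(esum_pred_image (vol \o uncurry G) _ xpredT) ?[fun=> _]set_true//.
    by rewrite image_eq.
  by move=> n _; exact: vol_ge0.
rewrite (_ : esum _ _ = \sum_(i <oo) \sum_(j <oo ) vol (G i j)); last first.
  pose J : nat -> set (nat * nat) := fun i => [set (i, j) | j in setT].
  rewrite (_ : setT = \bigcup_k J k); last first.
    by rewrite predeqE => -[a b]; split => // _; exists a => //; exists b.
  rewrite esum_bigcupT /=; last 2 first.
    - apply/trivIsetP => i j _ _ ij.
      rewrite predeqE => -[n m] /=; split => //= -[] [_] _ [<-{n} _].
      by move=> [m' _] [] /esym/eqP; rewrite (negbTE ij).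
    - by move=> [n m]; exact: vol_ge0.
  rewrite -(image_id [set: nat]) -fun_true esum_pred_image//; last first.
    by move=> n _; apply: esum_ge0 => x _; exact: vol_ge0.
  apply: eq_eseriesr => /= j _.
  rewrite -(esum_pred_image (vol \o uncurry G) (pair j) predT)//=; last first.
    by move=> ? ? _ _; exact: (@can_inj _ _ _ snd).
  by congr esum; rewrite predeqE => -[a b]; split; move=> [i _ <-]; exists i.
apply: lee_lim.
- apply: is_cvg_nneseries => n *.
  by apply: nneseries_ge0 => m *; exact: vol_ge0.
- by apply: is_cvg_nneseries => n *; apply: adde_ge0.
- by near=> n; apply: lee_sum => i _; exact: (PG i).2.
Unshelve. all: by end_near. Qed.

HB.instance Definition _ := isOuterMeasure.Build R 'rV[R]_d.+1 mu
  mu0 mu_ge0 mu_le mu_sigma_subadditive.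

End lebesgue_outer_measure.

Notation lebesgue_measurable S :=
  (measurable (S : set (caratheodory_type (@lebesgue_outer _ _)))).

(* Since Caratheodory measurability w.r.t. the outer measure is Lebesgue
   measurability, this is the complete Lebesgue measure; as a function it is
   defined on all sets, so that null sets need no measurability side condition. *)
Definition lebesgue_rV (R : realType) (d : nat) :
    set (caratheodory_type (@lebesgue_outer R d)) -> \bar R :=
  @lebesgue_outer R d.

Section lebesgue_rV.
Context (R : realType) (d : nat).
Local Notation mu := (@lebesgue_rV R d).

Let lebesgue_rV0 : mu set0 = 0%E.
Proof. exact: outer_measure0. Qed.

Let lebesgue_rV_ge0 A : (0 <= mu A)%E.
Proof. exact: outer_measure_ge0. Qed.

Let lebesgue_rV_sigma_additive : semi_sigma_additive mu.
Proof. exact: caratheodory_measure_sigma_additive. Qed.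

HB.instance Definition _ := isMeasure.Build _ _ _ mu
  lebesgue_rV0 lebesgue_rV_ge0 lebesgue_rV_sigma_additive.

End lebesgue_rV.

Section bounded_remainder.
Context (R : realType).

Definition irrational_vector (d : nat) (alpha : 'rV[R]_d) : Prop :=
  forall (c0 : rat) (c : 'I_d -> rat),
    ratr c0 + \sum_(i < d) ratr (c i) * alpha 0 i = 0 ->
    c0 = 0 /\ forall i, c i = 0.

Definition int_vec (d : nat) (m : 'rV[int]_d) : 'rV[R]_d := map_mx intr m.

Definition shift_group (d : nat) (alpha : 'rV[R]_d) : set 'rV[R]_d :=
  [set v | exists (n : int) (m : 'rV[int]_d), v = alpha *~ n + int_vec m].

(* For bounded [S] only finitely many terms of the sum are nonzero; the
   finitely supported sum is 0 by convention when there are infinitely many. *)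
Definition chi (d : nat) (S : set 'rV[R]_d) (x : 'rV[R]_d) : R :=
  \sum_(k \in [set: 'rV[int]_d]) (\1_S (x + int_vec k) : R).

(* Half-open fundamental domain representing the torus R^d / Z^d: "almost every
   x in the torus" is read as "almost every x in [unit_cell]". *)
Definition unit_cell (d : nat) : set 'rV[R]_d :=
  [set x | forall i, 0 <= x 0 i < 1].

Definition mes (d : nat) (S : set 'rV[R]_d.+1) : R := fine (lebesgue_rV S).

Definition bounded_remainder_set (d : nat) (alpha : 'rV[R]_d.+1)
    (S : set 'rV[R]_d.+1) : Prop :=
  [/\ bounded_set S, lebesgue_measurable S &
    exists C : R, forall n : nat, (1 <= n)%N ->
      {ae (@lebesgue_rV R d), forall x : 'rV[R]_d.+1, unit_cell x ->
        `| \sum_(0 <= k < n) chi S (x + alpha *+ k) - n%:R * mes S | <= C}].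

Definition boundary (d : nat) (S : set 'rV[R]_d) : set 'rV[R]_d :=
  closure S `\` interior S.

Definition riemann_measurable (d : nat) (S : set 'rV[R]_d.+1) : Prop :=
  bounded_set S /\ lebesgue_rV (boundary S) = 0%E.

Definition translate (d : nat) (g : 'rV[R]_d) (S : set 'rV[R]_d) :
    set 'rV[R]_d :=
  [set x + g | x in S].

(* The pieces partition [S] exactly (some may be empty); their translates
   partition [S'] up to Lebesgue-null sets. *)
Definition equidecomposable (d : nat) (G : set 'rV[R]_d.+1)
    (S S' : set 'rV[R]_d.+1) : Prop :=
  exists (N : nat) (P : 'I_N -> set 'rV[R]_d.+1) (g : 'I_N -> 'rV[R]_d.+1),
    [/\ forall j, riemann_measurable (P j),
        trivIset [set: 'I_N] P /\ \bigcup_j P j = S,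
        forall j, G (g j),
        forall i j, i != j ->
          lebesgue_rV (translate (g i) (P i) `&` translate (g j) (P j)) = 0%E &
        lebesgue_rV ((\bigcup_j translate (g j) (P j)) `+` S') = 0%E].

Definition parallelepiped (d : nat) (v : d.-tuple 'rV[R]_d) : set 'rV[R]_d :=
  [set \sum_(k < d) t k *: tnth v k
  | t in [set t : 'I_d -> R | forall k, 0 <= t k < 1]].

End bounded_remainder.

(* Main.v *)
Require Import Defs.
From mathcomp Require Import all_boot all_order all_algebra.
From mathcomp Require Import all_classical all_reals all_analysis.
From mathcomp Require Import finmap measurable_realfun ring lra zify.
Set Implicit Arguments.
Unset Strict Implicit.
Unset Printing Implicit Defensive.
Import Order.TTheory GRing.Theory Num.Theory.
Import numFieldNormedType.Exports.
Local Open Scope classical_set_scope.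
Local Open Scope ring_scope.

(** Write G for the group Z alpha + Z^d and, for a set A, consider the Birkhoff
    sums of its counting function [chi A] along the rotation by alpha.

    The sets of bounded discrepancy are stable under equidecomposition: moving a
    piece by n alpha + m changes its Birkhoff sums by a telescoping sum with |n|
    terms at each end ([birkhoff_shift_le]). A parallelepiped spanned by vectors
    of G has bounded discrepancy for the same reason. Moving it by s v_k, where
    v_k is one of its edges, takes a slab off one side and puts it back, shifted
    by v_k, on the other. So the Birkhoff sums of a parallelepiped oscillate
    boundedly in the starting point, and they are then close to n rho for some
    rho ([parallelepiped_discrepancy]). A set that is equidecomposable to a
    parallelepiped inherits this, and integration over a unit box shows that rho
    is its measure ([bounded_discrepancy_mes]).

    Conversely, let S have bounded discrepancy, and let mu be its measure. All
    null sets that intervene are put into one null set E, invariant under G. Off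
    E the function [chi S] is locally constant, and the bounded Birkhoff sums of
    [chi S] - mu provide a bounded function g, continuous off E,
    with g (x + alpha) = g x - (chi S x - mu) ([transfer_function]). As
    g (x + n alpha) - g x - n mu is an integer, n mu is close to an integer when
    n alpha is close to Z^d; by Kronecker's theorem mu then belongs to
    Z + Z alpha_1 + ... + Z alpha_d ([return_times_module]). For such a mu, the
    Smith normal form gives a parallelepiped spanned by vectors of G whose
    counting function is that of an interval of length mu on a circle, so that it
    has discrepancy bounded with density mu ([parallelepiped_of_density]).

    It remains to match S with this parallelepiped P. On each orbit of G, the
    points of S are queued in the order of time, and so are the points of P. The
    value n mu - g (x + n alpha) counts, up to a constant, the points of S that
    come before time n, so it ranks the points of S on the orbit
    ([rank_bijection]), and the transfer function of P ranks the points of P.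
    Equal ranks are matched. Since transfer functions are bounded, the
    displacements of this bijection form a finite subset of G; since they are
    continuous off E and ranks are integers, the displacement is locally constant
    off E, which makes the pieces Riemann measurable
    ([equal_density_equidecomposable]). *)

(** * Kronecker's theorem *)

(** Functions on ['I_d] and integer coefficients are what the induction on the
    number of reals in [kronecker] can handle. *)
Definition int_independent (R : realType) (d : nat) (t : 'I_d -> R) : Prop :=
  forall (c0 : int) (c : 'I_d -> int),
    c0%:~R + \sum_(i < d) (c i)%:~R * t i = 0 -> c0 = 0 /\ forall i, c i = 0.

Lemma irrational_int_independent (R : realType) (d : nat) (alpha : 'rV[R]_d) :
  irrational_vector alpha -> int_independent (alpha 0).
Proof.
move=> irr c0 c e.
have [] := irr (c0%:~R) (fun i => (c i)%:~R).
  by rewrite ratr_int -[RHS]e; congr (_ + _); apply: eq_bigr => i _; rewrite ratr_int.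
move=> /eqP; rewrite intr_eq0 => /eqP -> h; split=> // i.
by have /eqP := h i; rewrite intr_eq0 => /eqP.
Qed.

(** Pigeonhole: the fractional parts of n t, for n = 0, ..., N ^ d, lie in N ^ d
    cells of side 1 / N. *)
Lemma simultaneous_dirichlet (R : realType) (d : nat) (t : 'I_d -> R) (e : R) : 0 < e ->
  exists (q : int) (b : 'I_d -> int), q != 0 /\
    forall i, `|q%:~R * t i - (b i)%:~R| < e.
Proof.
move=> e0.
pose N := (Num.truncn e^-1).+1.
have N0 : 0 < N%:R :> R by rewrite ltr0n.
have Ne : N%:R^-1 < e.
  by rewrite invf_plt ?posrE//; apply: truncnS_gt.
pose fr (x : R) := x - (Num.floor x)%:~R.
have fr0 x : 0 <= fr x by rewrite subr_ge0 floor_le.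
have fr1 x : fr x < 1 by rewrite /fr ltrBlDl -intrD1 floorD1_gt.
have cellP x : (Num.truncn (N%:R * fr x) < N)%N.
  rewrite truncn_lt_nat ?mulr_ge0 ?ler0n//.
  by rewrite gtr_pMr.
pose cell x : 'I_N := Ordinal (cellP x).
pose F (n : 'I_(N ^ d).+1) : {ffun 'I_d -> 'I_N} :=
  [ffun i => cell (n%:R * t i)].
have /injectivePn[n1 [n2 n12 En]] : ~~ injectiveb F.
  apply/negP => /injectiveP/leq_card.
  by rewrite card_ord card_ffun !card_ord ltnn.
exists (n1%:Z - n2%:Z), (fun i => Num.floor (n1%:R * t i) - Num.floor (n2%:R * t i)).
split; first by rewrite subr_eq0; apply: contra n12 => /eqP[/val_inj ->].
move=> i; have /ffunP/(_ i) := En; rewrite !ffunE => /(congr1 val) /= E.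
have A x : (Num.truncn (N%:R * fr x))%:R <= N%:R * fr x < (Num.truncn (N%:R * fr x))%:R + 1.
  by rewrite natr1 truncn_itv// mulr_ge0// ler0n.
have := A (n1%:R * t i); have := A (n2%:R * t i); rewrite E => /andP[a1 a2] /andP[b1 b2].
have -> : (n1%:Z - n2%:Z)%:~R * t i -
    (Num.floor (n1%:R * t i) - Num.floor (n2%:R * t i))%:~R =
    fr (n1%:R * t i) - fr (n2%:R * t i).
  by rewrite /fr !intrB; ring.
apply: le_lt_trans Ne.
rewrite -(ler_pM2l N0) mulfV ?gt_eqF// -[X in X * _](gtr0_norm N0) -normrM.
by rewrite ler_norml; apply/andP; split; lra.
Qed.

(** Estermann's induction. Take q with all phi_i = q t_i - b_i small. The ratios
    phi_i / phi_0, for i > 0, satisfy the induction hypothesis, and this gives a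
    real s such that s phi is close to x modulo Z^d. Rounding s to an integer
    changes s phi by at most |phi|. *)
Lemma kronecker (R : realType) (d : nat) (t : 'I_d -> R) (x : 'I_d -> R) (e : R) :
  int_independent t -> 0 < e ->
  exists (n : int) (p : 'I_d -> int), forall i,
    `|n%:~R * t i + (p i)%:~R - x i| < e.
Proof.
elim: d t x e => [|d IH] t x e ind e0.
  by exists 0, (fun=> 0) => -[].
have e2 : 0 < e / 2 by rewrite divr_gt0.
have [q [b [q0 Hq]]] := simultaneous_dirichlet t e2.
pose phi i := q%:~R * t i - (b i)%:~R.
have indphi (c : 'I_d.+1 -> int) : \sum_i (c i)%:~R * phi i = 0 -> forall i, c i = 0.
  move=> s0 i.
  have [] := ind (- \sum_i (c i * b i)) (fun i => q * c i).
    rewrite -[RHS]s0 intrN rmorph_sum -sumrN -big_split; apply: eq_bigr => j _ /=.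
    by rewrite /phi !intrM; ring.
  by move=> _ /(_ i) /eqP; rewrite mulf_eq0 (negbTE q0) => /eqP.
have phi0 : phi ord0 != 0.
  apply/eqP => p0; have /(_ _ ord0) := indphi (fun i => (i == ord0)%:Z).
  rewrite eqxx big_ord_recl p0 mulr0 big1 ?addr0; last by move=> j _; rewrite mul0r.
  by move=> /(_ erefl).
pose psi (j : 'I_d) := phi (lift ord0 j) / phi ord0.
have [|n [p Hp]] := IH psi (fun j => x (lift ord0 j) - x ord0 * psi j) (e / 2) _ e2.
  move=> c0 c s0.
  have H := indphi (fun i => if unlift ord0 i is Some j then c j else c0).
  have {}H : forall i : 'I_d.+1, (if unlift ord0 i is Some j then c j else c0) = 0.
    apply: H; rewrite big_ord_recl unlift_none.
    rewrite (eq_bigr (fun j => phi ord0 * ((c j)%:~R * psi j))).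
      by rewrite -mulr_sumr mulrC -mulrDr s0 mulr0.
    by move=> j _; rewrite liftK /psi; field.
  split; first by have := H ord0; rewrite unlift_none.
  by move=> i; have := H (lift ord0 i); rewrite liftK.
(* With this s, the coordinate 0 is matched exactly: s phi_0 = x_0 + n. *)
pose s := (x ord0 + n%:~R) / phi ord0.
pose M := Num.floor s.
pose P i := if unlift ord0 i is Some j then p j else - n.
exists (M * q), (fun i => P i - M * b i) => i.
have -> : (M * q)%:~R * t i + (P i - M * b i)%:~R - x i =
    (M%:~R - s) * phi i + (s * phi i + (P i)%:~R - x i).
  by rewrite /phi intrB !intrM; ring.
have Ms : `|M%:~R - s| <= 1.
  have /andP[h1 h2] : M%:~R <= s < (M + 1)%:~R by rewrite floor_le floorD1_gt.
  rewrite intrD1 in h2.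
  by rewrite ler_norml; apply/andP; split; lra.
have A : `|(M%:~R - s) * phi i| < e / 2.
  rewrite normrM; apply: le_lt_trans (Hq i).
  by rewrite ler_piMl.
have B : `|s * phi i + (P i)%:~R - x i| < e / 2.
  rewrite /P; case: unliftP => [j|] ->.
    have := Hp j; congr (`|_| < _); rewrite /s /psi; field; exact: phi0.
  rewrite /s mulfVK// intrN (_ : _ - _ = 0) ?normr0//; ring.
by rewrite (splitr e); apply: le_lt_trans (ler_normD _ _) _; apply: ltrD.
Qed.

(** * Periodization and Birkhoff sums *)

Section norm.
Context (R : realType) (d : nat).
Local Notation V := 'rV[R]_d.
Implicit Types (x y : V) (S : set V) (c : R).

Lemma norm_rV_le x c : 0 <= c -> (`|x| <= c) <-> (forall i, `|x 0 i| <= c).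
Proof.
move=> c0; rewrite (_ : `|x| = mx_norm x)// mx_normrE; split=> [h i|h].
  by apply: le_trans h; apply: (le_bigmax _ _ (0, i)).
by apply: bigmax_le => // -[a i] _ /=; rewrite ord1.
Qed.

Lemma norm_rV_lt x c : 0 < c -> (`|x| < c) <-> (forall i, `|x 0 i| < c).
Proof.
move=> c0; rewrite (_ : `|x| = mx_norm x)// mx_normrE; split=> [h i|h].
  by apply: le_lt_trans h; apply: (le_bigmax _ _ (0, i)).
by apply: bigmax_lt => // -[a i] _ /=; rewrite ord1.
Qed.

Lemma norm_entry x i : `|x 0 i| <= `|x|.
Proof. by move: i; apply/norm_rV_le. Qed.

Lemma bounded_setP S : bounded_set S <-> exists2 K, 0 < K & forall x, S x -> `|x| <= K.
Proof.
split=> [[M [Mr hM]]|[K K0 hK]].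
  exists (Num.max 1 (M + 1)); first by rewrite lt_max ltr01.
  by apply: hM; rewrite lt_max ltrDl ltr01 orbT.
exists K; split; first exact: gtr0_real.
by move=> M KM x Sx /=; apply: le_trans (hK _ Sx) (ltW KM).
Qed.

Lemma nbhs_normP x S : nbhs x S <-> exists2 r, 0 < r & forall y, `|y - x| < r -> S y.
Proof.
split=> [/nbhs_ballP[r /= r0 h]|[r r0 h]].
  by exists r => // y yx; apply: h; rewrite -ball_normE /= distrC.
by apply/nbhs_ballP; exists r => // y; rewrite -ball_normE /= distrC => /h.
Qed.

Lemma openP S : open S <->
  forall x, S x -> exists2 r, 0 < r & forall y, `|y - x| < r -> S y.
Proof.
rewrite openE; split=> h x Sx; last exact/nbhs_normP/h.
exact/nbhs_normP/h.
Qed.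

Lemma closureP S x : closure S x <-> forall r, 0 < r -> exists2 y, S y & `|y - x| < r.
Proof.
split=> [h r r0|h A /nbhs_normP[r r0 rA]].
  have [y [Sy yr]] : S `&` [set y | `|y - x| < r] !=set0.
    by apply: h; apply/nbhs_normP; exists r.
  by exists y.
by have [y Sy yx] := h r r0; exists y; split=> //; exact: rA.
Qed.

End norm.

Section int_vec.
Context (R : realType) (d : nat).
Local Notation V := 'rV[R]_d.
Local Notation iv := (@int_vec R d).

Lemma int_vecD m p : iv (m + p) = iv m + iv p.
Proof. exact: map_mxD. Qed.

Lemma int_vecN m : iv (- m) = - iv m.
Proof. exact: map_mxN. Qed.

Lemma int_vec0 : iv 0 = 0.
Proof. by apply/rowP => i; rewrite !mxE. Qed.

Lemma int_vecE m i : iv m 0 i = (m 0 i)%:~R.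
Proof. by rewrite mxE. Qed.

Lemma mulrz_entry (W : zmodType) (x : 'rV[W]_d) (z : int) i : (x *~ z) 0 i = x 0 i *~ z.
Proof. by case: z => z; rewrite ?NegzE ?mulrNz ?mxE -?pmulrn mulmxnE. Qed.

Lemma int_vecMz m (z : int) : iv (m *~ z) = iv m *~ z.
Proof.
by apply/rowP => i; rewrite mulrz_entry !int_vecE mulrz_entry mulrzz intrM mulrzr.
Qed.

Lemma finite_int_interval (K : nat) : finite_set [set m : int | (`|m| <= K)%N].
Proof.
apply: (@sub_finite_set _ _ ((fun i : nat => i%:Z - K%:Z) @` `I_(K + K).+1)).
  move=> m /= mK; exists (absz (m + K%:Z)); lia.
exact/finite_image/finite_II.
Qed.

Lemma finite_window (x : V) (K : R) :
  finite_set [set k : 'rV[int]_d | `|x + iv k| <= K].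
Proof.
pose N := (Num.truncn (`|x| + K)).+1.
pose f (h : {ffun 'I_d -> 'I_(N + N).+1}) : 'rV[int]_d :=
  \row_i ((h i)%:Z - N%:Z).
apply: (@sub_finite_set _ _ (f @` setT)); last first.
  exact/finite_image/finite_finset.
move=> k /= hk.
have kN i : (`|k 0%R i| <= N)%N.
  have /le_lt_trans h : `|(k 0 i)%:~R : R| <= `|x| + K.
    rewrite -int_vecE (_ : iv k = (x + iv k) - x); last by rewrite addrC addKr.
    apply: le_trans (norm_entry _ _) _; apply: le_trans (ler_normB _ _) _.
    by rewrite addrC lerD2l.
  have := h _ (truncnS_gt _); rewrite -intr_norm -[X in _ < X]mulrz_nat ltr_int.
  rewrite -/N; lia.
have lt i : (absz (k 0 i + N%:Z)%R < (N + N).+1)%N by have := kN i; lia.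
exists [ffun i => Ordinal (lt i)] => //.
apply/rowP => i; rewrite mxE ffunE /=; have := kN i; lia.
Qed.

End int_vec.

Section periodization.
Context (R : realType) (d : nat).
Local Notation V := 'rV[R]_d.
Local Notation iv := (@int_vec R d).
Implicit Types (S : set V) (F G : V -> R) (x y : V) (K : R).

(** The counting function [chi S] is the periodization of an indicator. Functions
    are periodized here because, unlike sets, they can be added. *)
Definition periodize F x : R := \sum_(k \in [set: 'rV[int]_d]) F (x + iv k).

Definition supported K F := forall y, K < `|y| -> F y = 0.

Lemma chiE S : chi S = periodize (\1_S).
Proof. by []. Qed.

Lemma periodize_window K F x : supported K F ->
  periodize F x = \sum_(k \in [set k | `|x + iv k| <= K]) F (x + iv k).
Proof.
move=> FK; apply/esym/fsbig_widen => // k [_ /= /negP]; rewrite -ltNge.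
exact: FK.
Qed.

Lemma periodizeD K F G x : supported K F -> supported K G ->
  periodize (F \+ G) x = periodize F x + periodize G x.
Proof.
move=> FK GK; rewrite !(periodize_window (K := K))//.
  by rewrite fsbig_split//; apply: finite_window.
by move=> y /[dup] /FK /= -> /GK ->; rewrite addr0.
Qed.

Lemma periodize_sum K n (F : 'I_n -> V -> R) x : (forall i, supported K (F i)) ->
  periodize (fun y => \sum_i F i y) x = \sum_i periodize (F i) x.
Proof.
move=> FK; rewrite (periodize_window (K := K)); last first.
  by move=> y yK; rewrite big1// => i _; apply: FK.
rewrite fsbig_finite/=; last exact: finite_window.
rewrite exchange_big; apply: eq_bigr => i _.
by rewrite (periodize_window (K := K))// fsbig_finite//; exact: finite_window.
Qed.

Lemma eq_periodize F G x : (forall k, F (x + iv k) = G (x + iv k)) ->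
  periodize F x = periodize G x.
Proof. by move=> FG; apply: eq_fsbigr => k _. Qed.

Lemma periodize_int F x m : periodize F (x + iv m) = periodize F x.
Proof.
rewrite /periodize [RHS](reindex_fsbigT (fun k => m + k)); last first.
  by exists (fun k => k - m) => k; rewrite [m + _]addrC ?addrK ?subrK.
by apply: eq_fsbigr => k _; rewrite int_vecD addrA.
Qed.

Lemma supported_indic S K : (forall y, S y -> `|y| <= K) -> supported K (\1_S).
Proof.
move=> SK y yK; rewrite indicE memNset// => /SK.
by rewrite leNgt yK.
Qed.

Definition hits S x : set 'rV[int]_d := [set k | S (x + iv k)].

Lemma finite_hits S x : bounded_set S -> finite_set (hits S x).
Proof.
move=> /bounded_setP[K K0 SK].
by apply: sub_finite_set (finite_window x K) => k /SK.
Qed.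

Lemma chi_card S x : bounded_set S -> chi S x = #|` fset_set (hits S x)|%:R.
Proof.
move=> Sb; have [K K0 SK] := (bounded_setP _).1 Sb.
rewrite /chi -(fsbig_widen (hits S x))//; last first.
  by move=> k [_ /= h]; rewrite indicE memNset.
rewrite (eq_fsbigr (fun=> 1)) => [|k /set_mem h]; last by rewrite indicE mem_set.
rewrite fsbig_finite; last exact: finite_hits.
by rewrite card_fset_sum1 natr_sum.
Qed.

Lemma chi_ge0 S x : 0 <= chi S x.
Proof.
rewrite /chi; apply: fsumr_ge0 => k _; by rewrite indicE ler0n.
Qed.

(** Two hits of the same point differ by a vector of norm at most 2 K. Hence
    subtracting one hit maps all of them injectively into a window around 0,
    which does not depend on the point. *)
Lemma chi_le S : bounded_set S -> exists2 M, 0 <= M & forall x, chi S x <= M.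
Proof.
move=> Sb; have [K K0 SK] := (bounded_setP _).1 Sb.
exists #|` fset_set [set k : 'rV[int]_d | `|0 + iv k| <= K + K]|%:R => // x.
rewrite chi_card// ler_nat.
have [->|/set0P[k0 Sk0]] := eqVneq (hits S x) set0.
  by rewrite fset_set0 cardfs0.
have -> : #|` fset_set (hits S x)| =
    #|` [fset k - k0 | k in fset_set (hits S x)]%fset|.
  by rewrite card_imfset//; exact: addIr.
apply: fsubset_leq_card; apply/fsubsetP => _ /imfsetP[/= k + ->].
rewrite in_fset_set; last exact: finite_hits.
move=> /set_mem Sk.
rewrite in_fset_set; last exact: finite_window.
apply/mem_set => /=; rewrite add0r int_vecD int_vecN.
rewrite -[X in `|X|](_ : (x + iv k) - (x + iv k0) = _); last first.
  by rewrite opprD addrACA subrr add0r.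
by apply: le_trans (ler_normB _ _) _; apply: lerD; exact: SK.
Qed.


End periodization.

Section birkhoff.
Context (R : realType) (d : nat) (alpha : 'rV[R]_d).
Local Notation V := 'rV[R]_d.
Local Notation iv := (@int_vec R d).
Implicit Types (u : V -> R) (x y : V).

Definition birkhoff u (n : nat) x : R := \sum_(0 <= k < n) u (x + alpha *+ k).

Definition int_periodic u := forall x m, u (x + iv m) = u x.

Lemma chi_int_periodic (S : set V) : int_periodic (chi S).
Proof. by move=> x m; rewrite chiE periodize_int. Qed.

Lemma chi_translate (S : set V) g x : chi (translate g S) x = chi S (x - g).
Proof.
rewrite !chiE; apply: eq_fsbigr => k _; rewrite !indicE; congr (_%:R).
congr nat_of_bool; apply/idP/idP => /set_mem h; apply/mem_set.
  by case: h => y Sy e; rewrite addrAC -e addrK.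
by exists (x - g + iv k) => //; rewrite addrAC addrNK.
Qed.

(** The difference telescopes: only |n| terms remain at each end, whatever the
    length [N] of the sum. *)
Lemma birkhoff_shift_le u M N x v (n : int) m :
  int_periodic u -> (forall y, 0 <= u y <= M) -> v = alpha *~ n + iv m ->
  `|birkhoff u N (x - v) - birkhoff u N x| <= (absz n)%:R * M.
Proof.
move=> per uM ->.
have one y : `|birkhoff u N (y - alpha) - birkhoff u N y| <= M.
  rewrite /birkhoff -sumrB.
  rewrite (eq_bigr (fun k => - (u (y - alpha + alpha *+ k.+1) - u (y - alpha + alpha *+ k)))).
    rewrite sumrN telescope_sumr// normrN.
    have /andP[? ?] := uM (y - alpha + alpha *+ N).
    have /andP[? ?] := uM (y - alpha + alpha *+ 0).
    by rewrite ler_norml; apply/andP; split; lra.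
  by move=> k _; rewrite opprB mulrS addrA addrNK.
have many p : forall y, `|birkhoff u N (y - alpha *+ p) - birkhoff u N y| <= p%:R * M.
  elim: p => [y|p IH y]; first by rewrite mulr0n subr0 subrr normr0 mul0r.
  have -> : birkhoff u N (y - alpha *+ p.+1) - birkhoff u N y =
    (birkhoff u N (y - alpha *+ p - alpha) - birkhoff u N (y - alpha *+ p)) +
    (birkhoff u N (y - alpha *+ p) - birkhoff u N y).
    by rewrite mulrSr opprD addrA addrA addrNK.
  apply: le_trans (ler_normD _ _) _; rewrite -natr1 mulrDl mul1r addrC.
  exact: lerD.
have perB y l : birkhoff u N (y + iv l) = birkhoff u N y.
  by apply: eq_bigr => k _; rewrite addrAC per.
rewrite opprD addrA -int_vecN perB.
case: n => p; first exact: many.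
rewrite NegzE mulrNz opprK -[in X in _ - X](addrK (alpha *~ p.+1) x) distrC.
exact: many.
Qed.

End birkhoff.

(** * Volumes of covers by boxes *)

Section box_volume.
Context (R : realType).
Implicit Types (d : nat).

Definition rcoord d (s : R) (y : 'rV[R]_d) : 'rV[R]_d.+1 :=
  \row_i (if unlift ord0 i is Some j then y 0 j else s).

Definition rtail d (x : 'rV[R]_d.+1) : 'rV[R]_d := \row_j x 0 (lift ord0 j).

Lemma box_volume_ge0 d (B : 'rV[R]_d * 'rV[R]_d) : 0 <= box_volume B.
Proof. by apply: prodr_ge0 => i _; rewrite le_max lexx. Qed.

Lemma box_volume_recl d (B : 'rV[R]_d.+1 * 'rV[R]_d.+1) :
  box_volume B = Num.max 0 (B.2 0 ord0 - B.1 0 ord0) *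
                 box_volume (rtail B.1, rtail B.2).
Proof.
rewrite /box_volume big_ord_recl; congr (_ * _).
by apply: eq_bigr => j _; rewrite !mxE.
Qed.

Lemma box_rcoord d (B : 'rV[R]_d.+1 * 'rV[R]_d.+1) s y :
  box B (rcoord s y) <->
  (B.1 0 ord0 < s <= B.2 0 ord0) /\ box (rtail B.1, rtail B.2) y.
Proof.
split=> [h|[h0 h] i].
  split=> [|j]; first by have := h ord0; rewrite mxE unlift_none.
  by have := h (lift ord0 j); rewrite !mxE liftK.
rewrite mxE; case: unliftP => [j|] -> //.
by have := h j; rewrite !mxE.
Qed.

Local Open Scope ereal_scope.

(** By induction on the dimension: a slice of the cover at height s along the
    first coordinate is a weighted cover of the tail of [T], where the weight of
    a box is cancelled if the box misses the slice. The inequality for the slices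
    is then integrated over s. The weights are there for this induction. As series
    are integrated termwise, no compactness argument is needed. *)
Lemma box_volume_le_weighted_cover d (T : 'rV[R]_d * 'rV[R]_d) (M : R)
    (c : nat -> R) (B : nat -> 'rV[R]_d * 'rV[R]_d) :
  (0 <= M)%R -> (forall k, (0 <= c k)%R) ->
  (forall x, box T x -> M%:E <= \sum_(0 <= k <oo) (c k * \1_(box (B k)) x)%:E) ->
  (M * box_volume T)%:E <= \sum_(0 <= k <oo) (c k * box_volume (B k))%:E.
Proof.
elim: d T M c B => [|d IH] T M c B M0 c0 cov.
  have /cov : box T 0%R by case.
  rewrite /box_volume !big_ord0 mulr1 => /le_trans; apply.
  apply: lee_nneseries => [k _ _|k _].
    by rewrite lee_fin mulr_ge0// indicE ler0n.
  by rewrite big_ord0 lee_fin ler_wpM2l// indicE lern1 leq_b1.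
pose tl (C : 'rV[R]_d.+1 * 'rV[R]_d.+1) := (rtail C.1, rtail C.2).
pose I (C : 'rV[R]_d.+1 * 'rV[R]_d.+1) : set (measurableTypeR R) :=
  [set` `](C.1 0%R ord0), (C.2 0%R ord0)]].
have slice s : I T s -> (M * box_volume (tl T))%:E <=
    \sum_(0 <= k <oo) (c k * box_volume (tl (B k)) * \1_(I (B k)) s)%:E.
  move=> Is.
  rewrite (eq_eseriesr (g := fun k => (c k * \1_(I (B k)) s * box_volume (tl (B k)))%:E)).
    apply: IH => // [k|y Ty]; first by rewrite mulr_ge0// indicE ler0n.
    have /cov : box T (rcoord s y) by apply/box_rcoord; move: Is; rewrite /I/= in_itv.
    move=> /le_trans; apply; apply: lee_nneseries => [k _ _|k _].
      by rewrite lee_fin mulr_ge0// indicE ler0n.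
    rewrite lee_fin -mulrA ler_wpM2l// !indicE.
    have [|//] := boolP (rcoord s y \in box (B k)).
    move=> /set_mem/box_rcoord[h1 h2].
    by rewrite !mem_set// ?mulr1// /I /= in_itv.
    by move=> _; rewrite mulr_ge0 ?ler0n.
  by move=> k _; rewrite mulrAC.
have mI C : measurable (I C) by exact: measurable_itv.
have lI C : lebesgue_measure (I C) = (Num.max 0 (C.2 0%R ord0 - C.1 0%R ord0))%:E.
  rewrite /I lebesgue_measure_itv /= lte_fin; case: ifPn.
    by move=> h; rewrite -EFinB; congr EFin; apply/esym/max_idPr; rewrite subr_ge0 ltW.
  by rewrite -leNgt => h; congr EFin; apply/esym/max_idPl; rewrite subr_le0.
have int_le : \int[lebesgue_measure]_(s in I T) (cst (M * box_volume (tl T))%:E s) <=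
  \int[lebesgue_measure]_(s in I T)
    \sum_(0 <= k <oo) (c k * box_volume (tl (B k)) * \1_(I (B k)) s)%:E.
  have f0 k (s : R) : 0 <= (c k * box_volume (tl (B k)) * \1_(I (B k)) s)%:E.
    by rewrite lee_fin !mulr_ge0// ?box_volume_ge0// indicE ler0n.
  apply: ge0_le_integral => //.
  - by move=> s _; rewrite lee_fin mulr_ge0// box_volume_ge0.
  - apply: ge0_emeasurable_sum => [k s _ _|k _]; first exact: f0.
    by apply/measurable_EFinP; apply: measurable_funM.
rewrite integral_cst //= lI -EFinM in int_le.
rewrite box_volume_recl [(_ * box_volume _)%R]mulrC mulrA (le_trans int_le)//.
rewrite integral_nneseries//; last first.
- by move=> k s _; rewrite lee_fin !mulr_ge0// ?box_volume_ge0// indicE ler0n.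
- by move=> k; apply/measurable_EFinP; apply: measurable_funM.
apply: lee_nneseries => [k _ _|k _].
  by apply: integral_ge0 => s _; rewrite lee_fin !mulr_ge0// ?box_volume_ge0// indicE ler0n.
have cv0 : (0 <= c k * box_volume (tl (B k)))%R by rewrite mulr_ge0// box_volume_ge0.
under eq_integral do rewrite EFinM.
rewrite ge0_integralZl//; last exact/measurable_EFinP.
rewrite integral_indic// box_volume_recl [(Num.max _ _ * _)%R]mulrC mulrA.
rewrite [X in _ <= X]EFinM -lI lee_wpmul2l//; apply: le_measure;
  [exact/mem_set/measurableI|exact/mem_set|exact: subIsetl].
Qed.

End box_volume.

(** * Lebesgue measure: boxes, null sets and measurable sets *)

Lemma translateE (R : realType) d (g : 'rV[R]_d) S x : translate g S x <-> S (x - g).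
Proof.
split=> [[y Sy <-]|Sx]; first by rewrite addrK.
by exists (x - g) => //; rewrite subrK.
Qed.

Section lebesgue.
Context (R : realType) (d : nat).
Local Notation V := 'rV[R]_d.+1.
Local Notation iv := (@int_vec R d.+1).
Local Notation leb := (@lebesgue_outer R d).
Implicit Types (A S : set V) (g x : V) (B : V * V).
Local Open Scope ereal_scope.

Let le_outer_translate g A : leb (translate g A) <= leb A.
Proof.
apply: ereal_inf_le_tmp => _ [C AC <-].
exists (fun k => ((C k).1 + g, (C k).2 + g)%R).
  move=> x /translateE/AC[k _ h]; exists k => // i; have := h i.
  by rewrite !mxE /=; rewrite ltrBrDr lerBlDr.
apply: eq_eseriesr => k _; congr EFin; apply: eq_bigr => i _ /=.
by rewrite !mxE opprD addrACA subrr addr0.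
Qed.

Lemma lebesgue_outer_translate g A : leb (translate g A) = leb A.
Proof.
apply/eqP; rewrite eq_le le_outer_translate andTb.
have {1}-> : A = translate (- g) (translate g A).
  by apply/seteqP; split=> x; rewrite !translateE opprK addrK.
exact: le_outer_translate.
Qed.

Lemma lebesgue_outer_box_le B : leb (box B) <= (box_volume B)%:E.
Proof.
apply: ereal_inf_lbound; exists (fun k => if k is 0%N then B else (0, 0)%R : V * V).
  by move=> x Bx; exists 0%N.
rewrite nneseries_recl//; last by move=> k _; rewrite lee_fin box_volume_ge0.
rewrite eseries0 ?adde0// => -[|k] //= _ _.
by rewrite /box_volume big_ord_recl /= subrr maxxx mul0r.
Qed.

Lemma lebesgue_outer_box B : leb (box B) = (box_volume B)%:E.
Proof.
apply/eqP; rewrite eq_le lebesgue_outer_box_le /=.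
apply: le_ereal_inf_tmp => _ [C BC <-].
have := @box_volume_le_weighted_cover R _ B 1 (fun=> 1%R) C ler01 (fun=> ler01).
rewrite mul1r; under [X in _ -> _ <= X]eq_eseriesr do rewrite mul1r.
apply=> x /BC[k _ Ckx].
apply: (@le_trans _ _ (\sum_(0 <= i < k.+1) (1 * \1_(box (C i)) x)%:E)); last first.
  by apply: nneseries_lim_ge => i _ _; rewrite lee_fin mul1r indicE ler0n.
rewrite big_nat_recr//= mul1r indicE mem_set// -[X in X <= _]add0e leeD2r//.
by apply: sume_ge0 => i _; rewrite lee_fin mul1r indicE ler0n.
Qed.

Lemma null_subset A S : A `<=` S -> leb S = 0 -> leb A = 0.
Proof.
move=> AS S0; apply/eqP; rewrite eq_le -{1}S0 outer_measure_ge0 andbT.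
exact: le_outer_measure.
Qed.

Lemma null_bigcup (T : countType) (A : T -> set V) :
  (forall t, leb (A t) = 0) -> leb (\bigcup_t A t) = 0.
Proof.
move=> A0; pose F n := if @choice.unpickle T n is Some t then A t else set0.
apply: (@null_subset _ (\bigcup_n F n)).
  by move=> x [t _ Atx]; exists (choice.pickle t) => //; rewrite /F choice.pickleK.
have F0 n : leb (F n) = 0.
  by rewrite /F; case: choice.unpickle => [t|//]; rewrite ?outer_measure0.
apply/eqP; rewrite eq_le outer_measure_ge0 andbT.
apply: le_trans (outer_measure_sigma_subadditive leb F) _.
by rewrite eseries0 // => i _ _; exact: F0.
Qed.

Lemma null_setU A S : leb A = 0 -> leb S = 0 -> leb (A `|` S) = 0.
Proof.
move=> A0 S0; apply: (@null_subset _ (\bigcup_(b : bool) if b then A else S)).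
  by move=> x [Ax|Sx]; [exists true|exists false].
by apply: null_bigcup => -[].
Qed.

Lemma bounded_lebesgue_outer S : bounded_set S -> leb S < +oo.
Proof.
move=> /bounded_setP[K K0 SK].
pose B : V * V := (const_mx (- K - 1), const_mx K)%R.
apply: (@le_lt_trans _ _ (leb (box B))).
  apply: le_outer_measure => x /SK/(norm_rV_le _ (ltW K0)) h i.
  rewrite !mxE; have := h i; rewrite ler_norml => /andP[h1 h2].
  by rewrite h2 andbT (lt_le_trans _ h1)// ltrBlDr ltrDl.
by rewrite lebesgue_outer_box ltry.
Qed.

Lemma ball_not_null x (r : R) : (0 < r)%R -> leb [set y | (`|y - x| < r)%R] != 0.
Proof.
move=> r0; apply/eqP => h.
pose B : V * V := (x - const_mx (r / 2), x)%R.
have : leb (box B) = 0.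
  apply: (null_subset _ h) => y By /=; apply/norm_rV_lt => // i.
  have := By i; rewrite !mxE => /andP[h1 h2].
  by rewrite ltr_norml; apply/andP; split; lra.
rewrite lebesgue_outer_box => -[]; apply/eqP; rewrite gt_eqF// prodr_gt0// => i _.
rewrite !mxE; rewrite lt_max; apply/orP; right; lra.
Qed.

(** Estimates known almost everywhere are moved to every point off a null set by
    means of this density. *)
Lemma null_complement_dense A x (r : R) : leb A = 0 -> (0 < r)%R ->
  exists2 y, ~ A y & (`|y - x| < r)%R.
Proof.
move=> A0 r0; apply: contrapT => h; have := ball_not_null x r0.
rewrite (null_subset _ A0) ?eqxx// => y yx.
by apply: contrapT => nA; apply: h; exists y.
Qed.

(** A coordinate half-space and its complement cut each box of a cover into two
    boxes whose volumes add up. *)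
Lemma half_space_measurable (i : 'I_d.+1) (c : R) :
  lebesgue_measurable [set x : V | (x 0%R i <= c)%R].
Proof.
apply: le_caratheodory_measurable => X; apply: le_ereal_inf_tmp => _ [C XC <-].
pose C1 k : V * V := ((C k).1, \row_j if j == i then Num.min ((C k).2 0 j) c else (C k).2 0 j)%R.
pose C2 k : V * V := (\row_j if j == i then Num.max ((C k).1 0 j) c else (C k).1 0 j, (C k).2)%R.
have -> : \sum_(0 <= k <oo) (box_volume (C k))%:E =
  \sum_(0 <= k <oo) (box_volume (C1 k))%:E + \sum_(0 <= k <oo) (box_volume (C2 k))%:E.
  rewrite -nneseriesD; try by move=> k *; rewrite lee_fin box_volume_ge0.
  apply: eq_eseriesr => k _; apply/eqP; rewrite -EFinD eqe; apply/eqP.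
  rewrite /box_volume (bigD1 i)//= [X in _ = (X + _)%R](bigD1 i)//=.
  rewrite [X in _ = (_ + X)%R](bigD1 i)//= !mxE eqxx.
  have e1 : (\prod_(j < d.+1 | j != i) Num.max 0 ((C1 k).2 0 j - (C1 k).1 0 j) =
     \prod_(j < d.+1 | j != i) Num.max 0 ((C k).2 0 j - (C k).1 0 j))%R.
    by apply: eq_bigr => j /negbTE ji; rewrite !mxE ji.
  have e2 : (\prod_(j < d.+1 | j != i) Num.max 0 ((C2 k).2 0 j - (C2 k).1 0 j) =
     \prod_(j < d.+1 | j != i) Num.max 0 ((C k).2 0 j - (C k).1 0 j))%R.
    by apply: eq_bigr => j /negbTE ji; rewrite !mxE ji.
  rewrite e1 e2 -mulrDl; congr (_ * _)%R.
  rewrite /Num.max /Num.min; do ![case: ifPn => //]; rewrite -?leNgt; lra.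
apply: leeD; apply: ereal_inf_lbound.
  exists C1 => // x [/XC[k _ Ckx] /= xc]; exists k => // j.
  have := Ckx j; rewrite !mxE /=; case: ifP => // /eqP -> /andP[-> h] /=.
  by rewrite le_min h.
exists C2 => // x [/XC[k _ Ckx] /= /negP]; rewrite -ltNge => xc; exists k => // j.
have := Ckx j; rewrite !mxE /=; case: ifP => // /eqP -> /andP[h ->] /=.
by rewrite gt_max h xc.
Qed.

Lemma box_measurable B : lebesgue_measurable (box B).
Proof.
have -> : box B = \bigcap_(i in [set: 'I_d.+1])
    ([set x : V | x 0 i <= B.2 0 i] `\` [set x : V | x 0 i <= B.1 0 i])%R.
  apply/seteqP; split=> x h i; last by have [/= h1 /negP] := h i I; rewrite -ltNge => ->.
  by move=> _; have /andP[/= h1 h2] := h i; split=> //=; apply/negP; rewrite -ltNge.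
apply: fin_bigcap_measurable => // i _.
apply: measurableD; exact: half_space_measurable.
Qed.

(** An open set is the union of the countably many boxes with rational corners
    that it contains. *)
Lemma open_lebesgue_measurable A : open A -> lebesgue_measurable A.
Proof.
move=> /openP oA; pose q (a : 'rV[rat]_d.+1) : V := map_mx ratr a.
pose F n : set V := if @choice.unpickle ('rV[rat]_d.+1 * 'rV[rat]_d.+1)%type n is Some ab then
    (if `[< box (q ab.1, q ab.2) `<=` A >] then box (q ab.1, q ab.2) else set0)
  else set0.
have -> : A = \bigcup_n F n.
  apply/seteqP; split=> [x Ax|x [n _]]; last first.
    by rewrite /F; case: choice.unpickle => [ab|//]; case: asboolP => // h /h.
  have [r r0 rA] := oA _ Ax.
  have ex1 i : exists a : rat, (x 0 i - r < ratr a < x 0 i)%R.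
    have [|a] := rat_in_itvoo (x := (x 0 i - r)%R) (y := x 0%R i); first lra.
    by rewrite in_itv /= => ?; exists a.
  have ex2 i : exists a : rat, (x 0 i < ratr a < x 0 i + r)%R.
    have [|a] := rat_in_itvoo (x := x 0%R i) (y := (x 0 i + r)%R); first lra.
    by rewrite in_itv /= => ?; exists a.
  have [a ha] := boolp.choice ex1; have [b hb] := boolp.choice ex2.
  exists (choice.pickle (\row_i a i, \row_i b i)) => //; rewrite /F choice.pickleK /=.
  rewrite asboolT; last first.
    move=> y By; apply: rA; apply/norm_rV_lt => // i.
    have := By i; rewrite !mxE => /andP[h1 h2].
    have /andP[? ?] := ha i; have /andP[? ?] := hb i.
    by rewrite ltr_norml; apply/andP; split; lra.
  move=> i; rewrite !mxE.
  have /andP[? ?] := ha i; have /andP[? ?] := hb i.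
  by apply/andP; split; lra.
apply: bigcupT_measurable => n; rewrite /F; case: choice.unpickle => [ab|] //.
by case: asboolP => // _; exact: box_measurable.
Qed.

Lemma null_lebesgue_measurable A : leb A = 0 -> lebesgue_measurable A.
Proof.
move=> A0; apply: le_caratheodory_measurable => X.
rewrite (_ : _ (X `&` A) = 0); last by apply: null_subset A0 => x [].
rewrite add0e.
by apply: le_outer_measure => x [].
Qed.

Lemma riemann_lebesgue_measurable S : riemann_measurable S -> lebesgue_measurable S.
Proof.
move=> [_ bS0].
have -> : S = (interior S `|` (S `&` boundary S)).
  apply/seteqP; split=> x; last by case=> [/interior_subset|[]].
  move=> Sx; have [iS|niS] := pselect (interior S x); first by left.
  by right; split=> //; split=> //; apply: subset_closure.
apply: measurableU; first exact/open_lebesgue_measurable/open_interior.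
by apply: null_lebesgue_measurable; apply: null_subset bS0 => x [].
Qed.

End lebesgue.

(** * Null hyperplanes, and densities as measures *)

Section translates.
Context (R : realType) (d : nat).
Implicit Types (A B : set 'rV[R]_d) (g h : 'rV[R]_d).

Lemma translateI g A B : translate g (A `&` B) = translate g A `&` translate g B.
Proof.
apply/seteqP; split=> x; first by move=> /translateE[? ?]; split; apply/translateE.
by move=> [/translateE ? /translateE ?]; apply/translateE.
Qed.

Lemma translateC g A : translate g (~` A) = ~` translate g A.
Proof.
apply/seteqP; split=> x; first by move=> /translateE nA /translateE.
by move=> nA; apply/translateE => /translateE.
Qed.

Lemma translateD g h A : translate g (translate h A) = translate (h + g) A.
Proof.
by apply/seteqP; split=> x; rewrite !translateE opprD addrA addrAC.
Qed.

Lemma translate0 A : translate 0 A = A.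
Proof. by apply/seteqP; split=> x; rewrite translateE subr0. Qed.

Lemma translateK g A : translate (- g) (translate g A) = A.
Proof. by rewrite translateD subrr translate0. Qed.

End translates.

Section hyperplane.
Context (R : realType) (d : nat).
Local Notation V := 'rV[R]_d.+1.
Local Notation leb := (@lebesgue_outer R d).
Implicit Types (A S : set V) (g x : V).

Lemma translate_measurable g A :
  lebesgue_measurable A -> lebesgue_measurable (translate g A).
Proof.
move=> mA; suff : caratheodory_measurable leb (translate g A) by [].
have {}mA : caratheodory_measurable leb A by [].
move=> X; rewrite -(lebesgue_outer_translate (- g)) (mA (translate (- g) X)).
rewrite -(lebesgue_outer_translate (- g) (X `&` _)).
rewrite -(lebesgue_outer_translate (- g) (X `&` ~` _)).
by rewrite -translateC !translateI !translateK.
Qed.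

Lemma norm_mulmx_le n (x : 'rV[R]_n) m (a : 'M[R]_(n, m)) j :
  `|(x *m a) 0 j| <= `|x| * \sum_i `|a i j|.
Proof.
rewrite mxE mulr_sumr; apply: le_trans (ler_norm_sum _ _ _) _.
by apply: ler_sum => i _; rewrite normrM ler_wpM2r// norm_entry.
Qed.

Lemma hyperplane_measurable (a : 'cV[R]_d.+1) (c : R) :
  lebesgue_measurable [set x : V | (x *m a) 0 0 = c].
Proof.
rewrite -[X in lebesgue_measurable X]setCK; apply: measurableC.
apply/open_lebesgue_measurable/openP => x /= /eqP.
rewrite -subr_eq0 -normr_gt0 => h; pose s := \sum_i `|a i 0| + 1.
have s0 : 0 < s by rewrite ltr_wpDl// sumr_ge0.
exists (`|(x *m a) 0 0 - c| / s) => /=; first by rewrite divr_gt0.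
move=> y + /= yc; rewrite ltr_pdivlMr//.
apply/negP; rewrite -leNgt -yc distrC.
have -> : (y *m a) 0 0 - (x *m a) 0 0 = ((y - x) *m a) 0 0 by rewrite mulmxBl !mxE.
by apply: le_trans (norm_mulmx_le _ _ _) _; rewrite ler_wpM2l// lerDl.
Qed.

(** Let e be a vector with e a = 1. The translates of a bounded piece of the
    hyperplane by the vectors e / (n + 1) are disjoint, they have the same
    measure, and their union is bounded. *)
Lemma hyperplane_null (a : 'cV[R]_d.+1) (c : R) : a != 0 ->
  leb [set x : V | (x *m a) 0 0 = c] = 0%E.
Proof.
move=> a0; have [j aj] : exists j, a j 0 != 0.
  apply/existsP; apply: contraNT a0 => /existsPn h; apply/eqP/matrixP => i k.
  by rewrite ord1 mxE; apply/eqP; have := h i; rewrite negbK.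
pose e : V := (a j 0)^-1 *: delta_mx 0 j.
have ea : (e *m a) 0 0 = 1.
  by rewrite /e -scalemxAl -rowE !mxE mulVf.
have sub s (x : V) : ((x - s *: e) *m a) 0 0 = (x *m a) 0 0 - s.
  by rewrite mulmxBl -scalemxAl mxE [X in _ + X]mxE [X in _ - X]mxE ea mulr1.
pose Q (K : nat) : set V := [set x | (x *m a) 0 0 = c] `&`
  box (const_mx (- K%:R - 1), const_mx K%:R).
apply: (@null_subset _ _ _ (\bigcup_K Q K)).
  move=> x xc; exists (Num.truncn `|x|).+1 => //; split=> // i; rewrite !mxE /=.
  have := norm_entry x i; have := truncnS_gt `|x|; set K := _.+1%:R.
  by rewrite ler_norml => h /andP[h1 h2]; apply/andP; split; lra.
apply: null_bigcup => K.
have mQ : lebesgue_measurable (Q K).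
  apply: measurableI; [exact: hyperplane_measurable|exact: box_measurable].
pose T n := translate (n.+1%:R^-1 *: e) (Q K).
have mT n : lebesgue_measurable (T n) by exact: translate_measurable.
have tT : trivIset setT T.
  apply/trivIsetP => m n _ _; apply: contraNeq => /set0P[x [/translateE[/= xm _]]].
  move=> /translateE[/=]; rewrite -xm !sub => /addrI/oppr_inj/invr_inj/eqP + _.
  by rewrite eqr_nat eqSS => /eqP ->.
have bQ : bounded_set (\bigcup_n T n).
  apply/bounded_setP; exists (K%:R + 1 + `|e|).
    by rewrite -addrA ltr_wpDl// ltr_wpDr.
  move=> x [n _ /translateE[_ h]].
  rewrite -[x](subrK (n.+1%:R^-1 *: e)); apply: le_trans (ler_normD _ _) _.
  apply: lerD; last first.
    rewrite normrZ ger0_norm ?invr_ge0 ?ler0n// ler_piMl// invf_le1 ?ltr0n// ler1n//.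
  move: (x - _) h => y h; apply/norm_rV_le => [|i]; first by rewrite addr_ge0.
  have := h i; rewrite !mxE /= => /andP[h1 h2].
  by rewrite ler_norml; apply/andP; split; lra.
have fin := bounded_lebesgue_outer bQ.
have finQ : (leb (Q K) < +oo)%E.
  apply: le_lt_trans fin; rewrite -(lebesgue_outer_translate (1%:R^-1 *: e) (Q K)).
  by apply: le_outer_measure => x Tx; exists 0%N.
have le n : (n%:R%:E * leb (Q K) <= leb (\bigcup_n T n))%E.
  have <- : \sum_(i < n) leb (T i) = (n%:R%:E * leb (Q K))%E.
    rewrite (eq_bigr (fun=> leb (Q K))); last first.
      by move=> i _; exact: lebesgue_outer_translate.
    by rewrite sumr_const card_ord mule_natl.
  rewrite -(measure_bigsetU (lebesgue_rV (d := d)) mT tT n).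
  by apply: le_outer_measure => x; rewrite -bigcup_mkord => -[i _ Tx]; exists i.
have Q0 : (0 <= leb (Q K))%E by exact: outer_measure_ge0.
move: le finQ Q0 fin; move: (leb (Q K)) (leb (\bigcup_n T n)) => [r||] // [s||] //; last first.
  by move=> /(_ 0%N); rewrite mul0e.
move=> le _; rewrite lee_fin => r0 _; congr EFin; apply/eqP.
rewrite eq_le r0 andbT leNgt; apply/negP => r1.
have := le (Num.truncn (s / r)).+1; rewrite -EFinM lee_fin.
by rewrite leNgt -ltr_pdivrMr// truncnS_gt.
Qed.

End hyperplane.

Section density.
Context (R : realType) (d : nat) (alpha : 'rV[R]_d.+1).
Local Notation V := 'rV[R]_d.+1.
Local Notation iv := (@int_vec R d.+1).
Local Notation leb := (@lebesgue_outer R d).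
Local Notation mu := (@lebesgue_rV R d).
Local Notation U := (box (0 : V, const_mx 1 : V)).

Let mU : lebesgue_measurable U. Proof. exact: box_measurable. Qed.

Let leU : leb U = 1%E.
Proof.
rewrite lebesgue_outer_box /box_volume big1// => i _.
by rewrite !mxE subr0; apply/max_idPr.
Qed.

Let tiling (x : V) : exists! m, U (x + iv m).
Proof.
exists (\row_i (Num.floor (- x 0 i) + 1)); split.
  move=> i; rewrite !mxE intrD.
  have := floor_le (- x 0 i); have := floorD1_gt (- x 0 i); rewrite intrD.
  by move=> h1 h2; apply/andP; split; lra.
move=> m h; apply/rowP => i; rewrite mxE; have := h i; rewrite !mxE => /andP[h1 h2].
apply/eqP; rewrite eq_sym -subr_eq; apply/eqP/esym/floor_def.
by rewrite subrK intrB; apply/andP; split; lra.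
Qed.

Variable S : set V.
Hypotheses (bS : bounded_set S) (mS : lebesgue_measurable S).

(** On the unit box, [chi S] is a finite sum of indicators of translates of S, and
    the corresponding translates of the box cut S into pieces. *)
Let chi_cell y : exists W : set 'rV[int]_d.+1, finite_set W /\
  (forall x, U x -> chi S (x + y) =
    \sum_(m \in W) (\1_(translate (- (y + iv m)) S) x : R)) /\
  S `<=` \bigcup_(m in W) translate (y + iv m) U.
Proof.
have [K K0 SK] := (bounded_setP _).1 bS.
have U1 x : U x -> `|x| <= 1.
  move=> Ux; apply/norm_rV_le => // i; have := Ux i; rewrite !mxE /= => /andP[? ?].
  by rewrite ler_norml; apply/andP; split; lra.
exists [set m | `|y + iv m| <= K + 1]; split; first exact: finite_window.
split=> [x Ux|x Sx].
  rewrite /chi -(fsbig_widen [set m | `|y + iv m| <= K + 1])//.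
    apply: eq_fsbigr => m _; rewrite !indicE; congr (nat_of_bool _)%:R.
    by apply: asbool_equiv_eq; rewrite translateE opprK addrA.
  move=> m [_ /= /negP]; rewrite -ltNge => h; rewrite indicE memNset// => /SK.
  apply/negP; rewrite -ltNge; rewrite -addrA.
  have := ler_normB (x + (y + iv m)) x; rewrite addrAC subrr add0r.
  have := U1 _ Ux; lra.
have [m [Um _]] := tiling (x - y).
exists (- m); last by rewrite /= translateE int_vecN opprD opprK addrA.
rewrite /= int_vecN -[y - _](_ : x - (x - y + iv m) = _); last first.
  by rewrite opprD opprB addrA [x + _]addrC subrK.
by apply: le_trans (ler_normB _ _) _; apply: lerD; [exact: SK|exact: U1].
Qed.

Let int_chi y : measurable_fun (U : set (caratheodory_type leb))
    (fun x => (chi S (x + y))%:E) /\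
  (\int[mu]_(x in U) (chi S (x + y))%:E = leb S)%E.
Proof.
have [W [fW [chiW SW]]] := chi_cell y.
pose F m : set V := translate (- (y + iv m)) S.
have mF m : lebesgue_measurable (F m) by exact: translate_measurable.
have E : {in (U : set (caratheodory_type leb)),
   (fun x => \sum_(m \in W) (\1_(F m) x : R)%:E)%E =1
   (fun x => (chi S (x + y))%:E)}.
  by move=> x xU; rewrite /= chiW ?fsumEFin//; exact: set_mem xU.
split.
  apply: (eq_measurable_fun _ E).
  by apply: (emeasurable_fsum fW) => m; apply/measurable_EFinP; exact: measurable_indic.
transitivity (\int[mu]_(x in U) \sum_(m \in W) (\1_(F m) x : R)%:E)%E.
  by apply: eq_integral => x /E.
rewrite (ge0_integral_fsum mu mU _ _ fW); last 2 first.
- by move=> m; apply/measurable_EFinP; exact: measurable_indic.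
- by move=> m x _; rewrite lee_fin indicE ler0n.
have mG m : lebesgue_measurable (S `&` translate (y + iv m) U).
  by apply: measurableI => //; exact: translate_measurable.
rewrite [in RHS](_ : S = \bigcup_(m in W) (S `&` translate (y + iv m) U)); last first.
  by rewrite -setI_bigcupr; apply/esym/setIidPl.
have tr : trivIset W (fun m => S `&` translate (y + iv m) U).
  apply/trivIsetP => m p _ _; apply: contraNeq.
  move=> /set0P[x [[_ /translateE h1] [_ /translateE h2]]].
  have [q [_ uq]] := tiling (x - y).
  have e1 : q = - m by apply: uq; move: h1; rewrite opprD addrA int_vecN.
  have e2 : q = - p by apply: uq; move: h2; rewrite opprD addrA int_vecN.
  by apply/eqP/oppr_inj; rewrite -e1 -e2.
apply: (etrans _ (esym (measure_fin_bigcup mu fW tr (fun m _ => mG m)))).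
apply: eq_fsbigr => m _; rewrite integral_indic//.
rewrite -[RHS](lebesgue_outer_translate (- (y + iv m))); congr leb.
apply/seteqP; split=> x; rewrite /F /=.
  move=> [h Ux]; apply/translateE; split; first exact/translateE.
  by apply/translateE; rewrite opprK addrK.
by move=> /translateE[h /translateE]; rewrite opprK addrK => Ux; split=> //; exact/translateE.
Qed.

(** The integral over a unit box of a Birkhoff sum of length n is n mes S, because
    the translates of the box by Z^d tile the space. Hence n mes S and n rho
    differ by at most C for every n. *)
Lemma bounded_discrepancy_mes (E : set V) (rho C : R) : leb E = 0%E ->
  (forall x n, ~ E x -> `|birkhoff alpha (chi S) n x - n%:R * rho| <= C) ->
  mes S = rho.
Proof.
move=> E0 hE.
have Sfin : leb S = (mes S)%:E.
  by rewrite /mes fineK// ge0_fin_numE ?outer_measure_ge0//; exact: bounded_lebesgue_outer.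
have [x0 Ex0 _] := null_complement_dense 0 E0 (@ltr01 R).
have C0 : 0 <= C by apply: le_trans (hE _ 0%N Ex0).
have mb n : measurable_fun (U : set (caratheodory_type leb))
    (fun x => (birkhoff alpha (chi S) n x)%:E).
  under [X in measurable_fun _ X]eq_fun do rewrite -sumEFin.
  by apply: emeasurable_sum => k; exact: (int_chi _).1.
have b0 n x : 0 <= birkhoff alpha (chi S) n x.
  by apply: sumr_ge0 => k _; exact: chi_ge0.
have ib n : (\int[mu]_(x in U) (birkhoff alpha (chi S) n x)%:E = (n%:R * mes S)%:E)%E.
  under eq_integral do rewrite -sumEFin.
  rewrite (ge0_integral_sum mu mU); last 2 first.
  - by move=> k; exact: (int_chi _).1.
  - by move=> k x _; rewrite lee_fin chi_ge0.
  under eq_bigr do rewrite (int_chi _).2.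
  by rewrite Sfin sumEFin sumr_const_nat subn0 mulr_natl.
have aeE (P : V -> Prop) : (forall x, ~ E x -> P x) -> {ae mu, forall x, P x}.
  move=> EP; exists E; split=> //; first exact: null_lebesgue_measurable.
  by move=> x /= nP; apply: contrapT => /EP.
have mcst (r : R) : measurable_fun (U : set (caratheodory_type leb)) (cst r%:E) by [].
have icst r : (\int[mu]_(x in U) cst r%:E x = r%:E)%E.
  by rewrite integral_cst// (_ : _ U = 1%E) ?mule1//; exact: leU.
have up n : n%:R * mes S <= Num.max 0 (n%:R * rho + C).
  rewrite -lee_fin -ib -icst; apply: ae_ge0_le_integral => //.
  - by move=> x _; rewrite lee_fin.
  - by move=> x _; rewrite lee_fin le_max lexx.
  apply: aeE => x Ex; have := hE x n Ex; rewrite ler_norml => /andP[h1 h2] _.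
  by rewrite lee_fin le_max; apply/orP; right; lra.
have low n : Num.max 0 (n%:R * rho - C) <= n%:R * mes S.
  rewrite -lee_fin -ib -icst; apply: ae_ge0_le_integral => //.
  - by move=> x _; rewrite lee_fin le_max lexx.
  - by move=> x _; rewrite lee_fin.
  apply: aeE => x Ex; have := hE x n Ex; rewrite ler_norml => /andP[h1 h2] _.
  by rewrite lee_fin ge_max b0 /=; lra.
have close n : n%:R * `|mes S - rho| <= C.
  have h1 := up n; have h2 := low n; have := hE x0 n Ex0; have := b0 n x0.
  move: h2; rewrite ge_max => /andP[h0 h2].
  move: h1; rewrite le_max ler_norml => /orP h1 bb /andP[h3 h4].
  rewrite -[n%:R]ger0_norm ?ler0n// -normrM mulrBr ler_norml.
  by apply/andP; split; [|case: h1 => h1]; lra.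
apply/eqP; rewrite -subr_eq0 -normr_eq0 eq_le normr_ge0 andbT leNgt; apply/negP => h.
have := close (Num.truncn (C / `|mes S - rho|)).+1.
by rewrite leNgt -ltr_pdivrMr// truncnS_gt.
Qed.

End density.

(** * Transfer functions *)

(** Kronecker's theorem for the orbits of the rotation. *)
Lemma orbit_dense (R : realType) (d : nat) (alpha x y : 'rV[R]_d) (e : R) :
  irrational_vector alpha -> 0 < e ->
  exists n m, `|x + (alpha *~ n + int_vec R m) - y| < e.
Proof.
move=> /irrational_int_independent irr e0.
have [n [p Hp]] := kronecker (fun i => y 0 i - x 0 i) irr e0.
exists n, (\row_i p i); apply/norm_rV_lt => // i.
have := Hp i; rewrite !mxE -mulrzl; congr (`|_| < _).
rewrite mulrz_entry; ring.
Qed.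

Section transfer.
Context (R : realType) (d : nat) (alpha : 'rV[R]_d).
Local Notation V := 'rV[R]_d.
Local Notation iv := (@int_vec R d).
Implicit Types (f g : V -> R) (x y : V) (E : set V).

Definition orbit_invariant E := forall x n m, E x -> E (x + (alpha *~ n + iv m)).

Definition locally_constant_off E f := forall x, ~ E x ->
  exists2 r, 0 < r & forall y, `|y - x| < r -> f y = f x.

(** In contrast to [locally_constant_off], only points off [E] are tested: nothing
    is known about a transfer function on [E]. *)
Definition continuous_off E g := forall x e, ~ E x -> 0 < e ->
  exists2 r, 0 < r & forall y, ~ E y -> `|y - x| < r -> `|g y - g x| < e.

Lemma orbit_invariantN E x n m : orbit_invariant E ->
  ~ E x -> ~ E (x + (alpha *~ n + iv m)).
Proof.
move=> inv nE /(inv _ (- n) (- m)); rewrite mulrNz int_vecN -opprD addrK.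
exact: nE.
Qed.

(** Birkhoff sums over times of both signs. Their supremum over all times, unlike
    the supremum over positive times, satisfies the equation of
    [transfer_supS] exactly. *)
Definition cocycle f x (n : int) : R :=
  match n with
  | Posz n => birkhoff alpha f n x
  | Negz n => - birkhoff alpha f n.+1 (x - alpha *+ n.+1)
  end.

Lemma cocycleS f x n : cocycle f (x + alpha) n = cocycle f x (n + 1) - f x.
Proof.
case: n => [n|[|n]].
- rewrite -PoszD addn1 /= /birkhoff big_nat_recl//= mulr0n addr0 [RHS]addrAC subrr add0r.
  by apply: eq_bigr => k _; rewrite mulrS addrA.
- by rewrite /= /birkhoff big_nat1 big_geq// !mulr0n mulr1n addrK addr0 sub0r.
rewrite (_ : Negz n.+1 + 1 = Negz n); last by rewrite !NegzE; lia.
have e : x + alpha - alpha *+ n.+2 = x - alpha *+ n.+1.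
  by rewrite [alpha *+ n.+2]mulrS opprD addrA addrK.
by rewrite /= e /birkhoff big_nat_recr//= subrK opprD.
Qed.

Lemma cocycle_int_periodic f : int_periodic f -> forall n, int_periodic (cocycle f ^~ n).
Proof.
move=> per; have bper n x m : birkhoff alpha f n (x + iv m) = birkhoff alpha f n x.
  by apply: eq_bigr => k _; rewrite addrAC per.
by case=> n x m /=; rewrite ?[_ + _ - _]addrAC bper.
Qed.

Definition transfer_sup f x : R := sup [set cocycle f x n | n in [set: int]].

Lemma transfer_sup_int_periodic f : int_periodic f -> int_periodic (transfer_sup f).
Proof.
move=> per x m; congr sup; apply: eq_imagel => n _.
exact: cocycle_int_periodic.
Qed.

Variables (E : set V) (C : R).
Hypothesis E_inv : orbit_invariant E.

Definition bounded_off f := forall x n, ~ E x -> `|birkhoff alpha f n x| <= C.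

Section bounded.
Variable f : V -> R.
Hypotheses (f_per : int_periodic f) (f_bnd : bounded_off f)
  (f_loc : locally_constant_off E f).

Let inv1 : forall x (n : int), ~ E x -> ~ E (x + alpha *~ n).
Proof.
move=> x n nE; have := orbit_invariantN (n := n) (m := 0) E_inv nE.
by rewrite int_vec0 addr0.
Qed.
Arguments inv1 : clear implicits.

Lemma cocycle_bounded x n : ~ E x -> `|cocycle f x n| <= C.
Proof.
case: n => n nE /=; first exact: f_bnd.
rewrite normrN; apply: f_bnd.
by have := inv1 _ (Negz n) nE; rewrite NegzE mulrNz.
Qed.

Lemma cocycle_le_transfer_sup x n : ~ E x -> cocycle f x n <= transfer_sup f x.
Proof.
move=> nE; apply: ub_le_sup; last by exists n.
by exists C => _ [k _ <-]; apply: le_trans (ler_norm _) (cocycle_bounded k nE).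
Qed.

Lemma transfer_sup_le x c : (forall n, cocycle f x n <= c) -> transfer_sup f x <= c.
Proof.
by move=> h; apply: ge_sup; [exists (cocycle f x 0), 0|move=> _ [n _ <-]].
Qed.

Lemma transfer_supS x : ~ E x -> transfer_sup f (x + alpha) = transfer_sup f x - f x.
Proof.
move=> nE; have nE' : ~ E (x + alpha) by have := inv1 _ 1 nE; rewrite mulr1z.
apply/eqP; rewrite eq_le; apply/andP; split.
  apply: transfer_sup_le => n; rewrite cocycleS lerD2r.
  exact: cocycle_le_transfer_sup.
rewrite lerBlDr; apply: transfer_sup_le => n.
have := cocycle_le_transfer_sup (n - 1) nE'; rewrite cocycleS subrK.
by rewrite lerBlDr.
Qed.

Lemma transfer_sup_bounded x : ~ E x -> `|transfer_sup f x| <= C.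
Proof.
move=> nE; rewrite ler_norml; apply/andP; split.
  apply: le_trans (cocycle_le_transfer_sup 0 nE).
  by have := cocycle_bounded 0 nE; rewrite ler_norml => /andP[].
apply: transfer_sup_le => n.
by have := cocycle_bounded n nE; rewrite ler_norml => /andP[].
Qed.

Lemma locally_constant_birkhoff n x : ~ E x ->
  exists2 r, 0 < r & forall y, `|y - x| < r -> birkhoff alpha f n y = birkhoff alpha f n x.
Proof.
move=> nE; elim: n => [|n [r r0 IH]].
  by exists 1 => // y _; rewrite /birkhoff !big_geq.
have [s s0 fs] := f_loc (inv1 _ n nE).
exists (Num.min r s); first by rewrite lt_min r0.
move=> y; rewrite lt_min => /andP[yr ys].
rewrite /birkhoff !big_nat_recr//= -!/(birkhoff _ _ _ _) IH// fs//.
by rewrite opprD addrACA subrr addr0.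
Qed.

(** Near a point off [E], a supremum of locally constant functions can only
    increase, up to [e]. *)
Lemma transfer_sup_lsc x e : ~ E x -> 0 < e -> exists2 r, 0 < r &
  forall y, ~ E y -> `|y - x| < r -> transfer_sup f x - e < transfer_sup f y.
Proof.
move=> nE e0; have [_ [n _ <-] hn] : exists2 z,
    [set cocycle f x n | n in [set: int]] z & transfer_sup f x - e < z.
  apply: sup_adherent => //; split; first by exists (cocycle f x 0), 0.
  by exists C => _ [k _ <-]; apply: le_trans (ler_norm _) (cocycle_bounded k nE).
have [r r0 hr] : exists2 r, 0 < r & forall y, `|y - x| < r -> cocycle f y n = cocycle f x n.
  case: n {hn} => n; first exact: locally_constant_birkhoff.
  have [r r0 hr] := locally_constant_birkhoff n.+1 (inv1 _ (Negz n) nE).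
  exists r => // y yx; rewrite /= -(hr (y - alpha *+ n.+1)).
    by rewrite hr ?NegzE ?mulrNz// opprB addrA subrK.
  by rewrite NegzE mulrNz opprB addrA subrK.
exists r => // y nEy yx; apply: lt_le_trans hn _.
by rewrite -(hr y yx); exact: cocycle_le_transfer_sup.
Qed.

End bounded.

(** This is the argument of Gottschalk and Hedlund. Let g be the supremum of the
    cocycle of [f] and h that of the cocycle of - f. Both are lower
    semicontinuous, and g + h is invariant under the rotation. An invariant lower
    semicontinuous function is constant, since orbits are dense. So g is a
    constant minus h, hence also upper semicontinuous. *)
Theorem transfer_function f : irrational_vector alpha ->
  int_periodic f -> bounded_off f -> locally_constant_off E f ->
  exists g, [/\ int_periodic g, forall x, ~ E x -> `|g x| <= C,
    forall x, ~ E x -> g (x + alpha) = g x - f x & continuous_off E g].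
Proof.
move=> irr per bnd loc.
have bndN : bounded_off (\- f).
  by move=> x n nE; rewrite /birkhoff sumrN normrN; exact: bnd.
have perN : int_periodic (\- f) by move=> x m; rewrite /= per.
have locN : locally_constant_off E (\- f).
  by move=> x /loc[r r0 h]; exists r => // y /h /= ->.
pose g := transfer_sup f; pose h := transfer_sup (\- f).
exists g; split.
- exact: transfer_sup_int_periodic.
- exact: transfer_sup_bounded.
- exact: transfer_supS.
have DS x : ~ E x -> g (x + alpha) + h (x + alpha) = g x + h x.
  by move=> nE; rewrite /g /h !transfer_supS//=; lra.
have inv1 x (n : int) : ~ E x -> ~ E (x + alpha *~ n).
  by move=> nE; have := orbit_invariantN (n := n) (m := 0) E_inv nE; rewrite int_vec0 addr0.
have Dn x (n : nat) : ~ E x -> g (x + alpha *+ n) + h (x + alpha *+ n) = g x + h x.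
  move=> nE; elim: n => [|n IH]; first by rewrite mulr0n addr0.
  by rewrite mulrSr addrA DS ?IH//; exact: (inv1 _ n).
have D x n m : ~ E x -> g (x + (alpha *~ n + iv m)) + h (x + (alpha *~ n + iv m)) = g x + h x.
  move=> nE; rewrite addrA /g /h !transfer_sup_int_periodic// -/g -/h.
  case: n => n; first exact: Dn.
  rewrite -(Dn (x + alpha *~ Negz n) n.+1); last exact: inv1.
  by rewrite NegzE mulrNz addrNK.
(* Compare with a point of the orbit of y that is close to x. *)
have Dle x y : ~ E x -> ~ E y -> g x + h x <= g y + h y.
  move=> nEx nEy; apply/ler_addgt0Pr => e e0.
  have e2 : 0 < e / 2 by rewrite divr_gt0.
  have [r r0 gr] := transfer_sup_lsc bnd loc nEx e2.
  have [s s0 hs] := transfer_sup_lsc bndN locN nEx e2.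
  have rs : 0 < Num.min r s by rewrite lt_min r0.
  have [n [m]] := orbit_dense y x irr rs; rewrite lt_min => /andP[yr ys].
  have nE' := orbit_invariantN (n := n) (m := m) E_inv nEy.
  have := gr _ nE' yr; have := hs _ nE' ys; have := D y n m nEy.
  rewrite /g /h; lra.
move=> x e nE e0.
have [r r0 gr] := transfer_sup_lsc bnd loc nE e0.
have [s s0 hs] := transfer_sup_lsc bndN locN nE e0.
exists (Num.min r s); first by rewrite lt_min r0.
move=> y nEy; rewrite lt_min => /andP[yr ys].
have := gr _ nEy yr; have := hs _ nEy ys; have := Dle _ _ nE nEy; have := Dle _ _ nEy nE.
rewrite /g /h => *.
by rewrite ltr_norml; apply/andP; split; lra.
Qed.

End transfer.

(** * Densities lie in the module generated by 1 and alpha *)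

Lemma intr_eq0_lt1 (R : realType) (z : int) : `|z%:~R : R| < 1 -> z = 0.
Proof.
rewrite -intr_norm -[ltRHS]/(1%:~R) ltr_int => h; apply/eqP.
by rewrite -normr_eq0 eq_le normr_ge0 andbT; lia.
Qed.

(** If 1, alpha_1, ..., alpha_d, mu were independent, some return time n of alpha
    to a neighbourhood of 0 would have n mu close to 1/2. So
    q mu = P0 + P_1 alpha_1 + ... + P_d alpha_d with integers and q <> 0. Let r and
    v be integers. Kronecker's theorem, applied with the target (v - r alpha) / q,
    gives n = r modulo q such that n alpha is close to v modulo q Z^d. As n mu is
    then close to an integer, q divides r P0 + P_1 v_1 + ... + P_d v_d. Hence q
    divides P0 and all P_j. *)
Lemma return_times_module (R : realType) (d : nat) (alpha : 'rV[R]_d) (mu : R) :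
  irrational_vector alpha ->
  (forall e, 0 < e -> exists2 r, 0 < r & forall n m,
     `|alpha *~ n + int_vec R m| < r -> exists j : int, `|n%:~R * mu - j%:~R| < e) ->
  exists (p0 : int) (p : 'I_d -> int), mu = p0%:~R + \sum_i (p i)%:~R * alpha 0 i.
Proof.
move=> /irrational_int_independent irr close.
have shiftE n m i : (alpha *~ n + int_vec R m) 0 i = n%:~R * alpha 0 i + (m 0 i)%:~R.
  by rewrite mxE mulrz_entry int_vecE mulrzl.
pose t i := if unlift ord0 i is Some j then alpha 0 j else mu.
have : ~ int_independent t.
  move=> ind; have [|r r0 hr] := close 4^-1; first by rewrite invr_gt0.
  have [|n [p hp]] := kronecker (fun i => if i == ord0 then 2^-1 else 0)
      (e := Num.min r 4^-1) ind.
    by rewrite lt_min r0 invr_gt0 ltr0n.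
  have [|j hj] := hr n (\row_i p (lift ord0 i)).
    apply/norm_rV_lt => // i; rewrite shiftE mxE.
    by have := hp (lift ord0 i); rewrite /t liftK subr0 lt_min => /andP[].
  have := hp ord0; rewrite /t unlift_none eqxx lt_min => /andP[_].
  move: hj; rewrite !ltr_norml => /andP[h1 h2] /andP[h3 h4].
  have h5 : (0%:~R : R) < (j + p ord0)%:~R by rewrite intrD; lra.
  have h6 : (j + p ord0)%:~R < (1%:~R : R) by rewrite intrD; lra.
  by move: h5 h6; rewrite !ltr_int; lia.
move=> /existsNP[c0] /existsNP[c] /not_implyP[s0 cn0].
pose q := c ord0; pose P0 := - c0; pose P j := - c (lift ord0 j).
have qmu : q%:~R * mu = P0%:~R + \sum_j (P j)%:~R * alpha 0 j.
  have S : \sum_(i < d) (P i)%:~R * alpha 0 i = - \sum_(i < d) (c (lift ord0 i))%:~R * alpha 0 i.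
    by rewrite -sumrN; apply: eq_bigr => i _; rewrite /P intrN mulNr.
  move: s0; rewrite big_ord_recl {1}/t unlift_none.
  under eq_bigr do rewrite /t liftK.
  by rewrite S /P0 intrN; set s := \sum_(_ < _) _; rewrite -/q; lra.
have q0 : q != 0.
  apply/eqP => q0; apply: cn0; have [|a b] := irr c0 (fun j => c (lift ord0 j)).
    move: qmu; rewrite q0 mul0r => /esym e.
    apply: oppr_inj; rewrite oppr0 -[RHS]e opprD /P0 intrN; congr (_ + _).
    by rewrite -sumrN; apply: eq_bigr => i _; rewrite /P intrN mulNr.
  by split=> // i; case: (unliftP ord0 i) => [j|] -> //.
have qr0 : 0 < `|q%:~R : R| by rewrite normr_gt0 intr_eq0.
have div r (v : 'I_d -> int) : exists a : int, r * P0 + \sum_j P j * v j = q * a.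
  pose L : R := \sum_j `|(P j)%:~R| + 1.
  have L0 : 0 < L by rewrite ltr_wpDl// sumr_ge0.
  have [|dl dl0 hdl] := close (`|q%:~R|^-1 / 4).
    by rewrite divr_gt0// invr_gt0.
  pose eps := Num.min dl (L^-1 / 4).
  have eps0 : 0 < eps by rewrite lt_min dl0 divr_gt0// invr_gt0.
  have [|n' [w hw]] := kronecker (fun j => ((v j)%:~R - r%:~R * alpha 0 j) / q%:~R)
     (e := eps / `|q%:~R|) irr; first by rewrite divr_gt0.
  pose n := r + q * n'; pose m : 'rV[int]_d := \row_j (q * w j - v j).
  have eta j : `|(alpha *~ n + int_vec R m) 0 j| < eps.
    have := hw j; rewrite ltr_pdivlMr// -normrM; congr (`|_| < _).
    rewrite shiftE mxE /n intrD intrB !intrM; field.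
    by rewrite intr_eq0.
  have [|j0 hj0] := hdl n m.
    apply/norm_rV_lt => // i; apply: lt_le_trans (eta i) _.
    by rewrite ge_min lexx.
  pose a := - (n' * P0 - \sum_j P j * w j - j0).
  exists a; apply/eqP; rewrite -subr_eq0; apply/eqP/(@intr_eq0_lt1 R).
  have E : (r * P0 + \sum_j P j * v j - q * a)%:~R =
    q%:~R * (n%:~R * mu - j0%:~R) - \sum_j (P j)%:~R * (alpha *~ n + int_vec R m) 0 j.
    have -> : \sum_j (P j)%:~R * (alpha *~ n + int_vec R m) 0 j =
       n%:~R * (\sum_j (P j)%:~R * alpha 0 j) + q%:~R * (\sum_j P j * w j)%:~R -
       (\sum_j P j * v j)%:~R.
      rewrite !rmorph_sum !mulr_sumr -sumrN -!big_split; apply: eq_bigr => i _ /=.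
      by rewrite shiftE mxE intrB !intrM; ring.
    rewrite mulrBr [q%:~R * (n%:~R * mu)]mulrCA qmu /a /n.
    by rewrite !(intrD, intrB, intrM, intrN); ring.
  rewrite E; have b1 : `|q%:~R * (n%:~R * mu - j0%:~R)| < 4^-1.
    rewrite normrM -ltr_pdivlMl//; exact: hj0.
  have b2 : `|\sum_j (P j)%:~R * (alpha *~ n + int_vec R m) 0 j| <= 4^-1.
    apply: le_trans (ler_norm_sum _ _ _) _.
    apply: (@le_trans _ _ (\sum_j `|(P j)%:~R| * (L^-1 / 4))).
      apply: ler_sum => j _; rewrite normrM ler_wpM2l//.
      by apply: le_trans (ltW (eta j)) _; rewrite ge_min lexx orbT.
    rewrite -mulr_suml mulrA ler_piMl ?invr_ge0// ler_pdivrMr// mul1r /L.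
    by rewrite lerDl.
  by apply: le_lt_trans (ler_normB _ _) _; lra.
have [a0 ha0] : exists a, P0 = q * a.
  have [a] := div 1 (fun=> 0); rewrite mul1r big1 ?addr0; first by exists a.
  by move=> i _; rewrite mulr0.
have hai i : exists a, P i = q * a.
  have [a] := div 0 (fun j => (j == i)%:Z); rewrite mul0r add0r (bigD1 i)//= eqxx mulr1.
  rewrite big1 ?addr0; first by exists a.
  by move=> j /negbTE ->; rewrite mulr0.
have [p hp] := boolp.choice hai.
exists a0, p; have qn0 : (q%:~R : R) != 0 by rewrite intr_eq0.
apply: (mulfI qn0); rewrite qmu ha0 intrM mulrDr; congr (_ + _).
by rewrite mulr_sumr; apply: eq_bigr => i _; rewrite hp intrM mulrA.
Qed.

(** * Parallelepipeds and their boundaries *)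

Lemma chi_bij (R : realType) d (S : set 'rV[R]_d) x N (h : nat -> 'rV[int]_d) :
  set_bij `I_N (hits S x) h -> chi S x = N%:R.
Proof.
move=> hb; rewrite /chi -(fsbig_widen (hits S x))//; last first.
  by move=> k [_ /= nS]; rewrite indicE memNset.
rewrite (eq_fsbigr (fun=> 1)) => [|k /set_mem Sk]; last by rewrite indicE mem_set.
rewrite (reindex_fsbig h _ _ _ hb) -fsbig_ord/=.
by rewrite sumr_const card_ord.
Qed.

Section parallelepiped.
Context (R : realType) (n : nat).
Local Notation V := 'rV[R]_n.
Implicit Types (v : n.-tuple V) (x : V).

Definition row_matrix v : 'M[R]_n := \matrix_i tnth v i.

Lemma parallelepiped_mulmx v x : parallelepiped v x <->
  exists2 t : V, (forall k, 0 <= t 0 k < 1) & x = t *m row_matrix v.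
Proof.
have E (t : 'I_n -> R) : \sum_k t k *: tnth v k = (\row_k t k) *m row_matrix v.
  by rewrite mulmx_sum_row; apply: eq_bigr => i _; rewrite mxE rowK.
split=> [[t /= ht <-]|[t ht ->]].
  by exists (\row_k t k); rewrite ?E// => k; rewrite mxE.
exists (t 0) => //=; rewrite E; congr (_ *m _).
by apply/rowP => i; rewrite mxE.
Qed.

Lemma free_row_matrix v : free v = (row_matrix v \in unitmx).
Proof.
have E (t : 'I_n -> R) : \sum_k t k *: v`_k = (\row_k t k) *m row_matrix v.
  by rewrite mulmx_sum_row; apply: eq_bigr => i _; rewrite mxE rowK (tnth_nth 0).
rewrite -row_free_unit; apply/idP/idP.
  move=> /freeP h; apply/inj_row_free => t t0.
  apply/rowP => i; rewrite mxE; apply: (h (t 0)); rewrite E -[RHS]t0; congr (_ *m _).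
  by apply/rowP => k; rewrite mxE.
move=> uM; apply/freeP => t; rewrite E => /(congr1 (mulmx^~ (invmx (row_matrix v)))).
rewrite mulmxK -?row_free_unit// mul0mx => /rowP h i.
by have := h i; rewrite !mxE.
Qed.

Lemma parallelepiped_coord v x : free v ->
  parallelepiped v x <-> forall k, 0 <= (x *m invmx (row_matrix v)) 0 k < 1.
Proof.
rewrite free_row_matrix => uM; rewrite parallelepiped_mulmx; split=> [[t ht ->] k|h].
  by rewrite mulmxK.
by exists (x *m invmx (row_matrix v)) => //; rewrite mulmxKV.
Qed.

Lemma bounded_parallelepiped v : bounded_set (parallelepiped v).
Proof.
apply/bounded_setP; exists (\sum_k `|tnth v k| + 1).
  by rewrite ltr_wpDl// sumr_ge0.
move=> _ [t ht <-]; apply: le_trans (ler_norm_sum _ _ _) _.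
apply: ler_wpDr => //; apply: ler_sum => k _; have /andP[t0 t1] := ht k.
by rewrite normrZ ger0_norm// ler_piMl// ltW.
Qed.

End parallelepiped.

Section parallelepiped_boundary.
Context (R : realType) (d : nat).
Local Notation V := 'rV[R]_d.+1.

Lemma near_mulmx_pos (N : 'M[R]_d.+1) (k : 'I_d.+1) (c s : R) (x : V) :
  0 < s * (x *m N) 0 k + c ->
  exists2 r, 0 < r & forall y, `|y - x| < r -> 0 < s * (y *m N) 0 k + c.
Proof.
set p := _ + c => p0; pose L := `|s| * (\sum_i `|N i k|) + 1.
have L0 : 0 < L by rewrite ltr_wpDl// mulr_ge0// sumr_ge0.
exists (p / L); first by rewrite divr_gt0.
move=> y; rewrite ltr_pdivlMr// => yx.
have -> : s * (y *m N) 0 k + c = p + s * ((y - x) *m N) 0 k.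
  have -> : ((y - x) *m N) 0 k = (y *m N) 0 k - (x *m N) 0 k.
    by rewrite mulmxBl mxE [X in _ + X]mxE.
  rewrite /p; ring.
rewrite -ltrBlDl sub0r ltrNl; apply: le_lt_trans yx.
apply: le_trans (ler_norm _) _; rewrite normrN normrM.
apply: (@le_trans _ _ (`|s| * (`|y - x| * \sum_i `|N i k|))).
  by rewrite ler_wpM2l// norm_mulmx_le.
by rewrite mulrCA ler_wpM2l// lerDl.
Qed.

(** A boundary point has a coordinate equal to 0 or 1, in the basis of the edges. *)
Lemma parallelepiped_boundary_null (v : (d.+1).-tuple V) : free v ->
  lebesgue_outer (boundary (parallelepiped v)) = 0%E.
Proof.
move=> fv; have uM := fv; rewrite free_row_matrix in uM.
set N := invmx (row_matrix v).
pose H k c := [set x : V | (x *m col k N) 0 0 = c].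
have colNE (x : V) k : (x *m col k N) 0 0 = (x *m N) 0 k.
  by rewrite colE mulmxA -colE mxE.
have Nk k : col k N != 0.
  apply/eqP => Nk0; have : (row k (row_matrix v) *m N) 0 k = 0.
    by rewrite -colNE Nk0 mulmx0 mxE.
  by rewrite -row_mul mulmxV// row1 !mxE !eqxx /= => /eqP; rewrite oner_eq0.
apply: (@null_subset _ _ _ (\bigcup_(kb : 'I_d.+1 * bool) H kb.1 kb.2%:R)); last first.
  by apply: null_bigcup => -[k b]; exact: hyperplane_null.
move=> x [cx ix]; apply: contrapT => nH; apply: ix.
have ne k (b : bool) : (x *m N) 0 k != b%:R.
  by apply/eqP => e; apply: nH; exists (k, b) => //; rewrite /H /= colNE.
have in01 k : 0 < (x *m N) 0 k < 1.
  apply: contrapT => /negP nk.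
  have out s c : 0 < s * (x *m N) 0 k + c ->
      (forall y, parallelepiped v y -> s * (y *m N) 0 k + c <= 0) -> False.
    move=> /near_mulmx_pos[r r0 hr] hP.
    have [y Py yx] := (closureP _ _).1 cx r r0.
    by have := hr y yx; rewrite ltNge hP.
  have /orP[h|h] : (((x *m N) 0 k < 0) || (1 < (x *m N) 0 k)).
    move: nk; rewrite negb_and -!leNgt.
    by rewrite !le_eqVlt (negbTE (ne k false)) eq_sym (negbTE (ne k true)).
  - apply: (out (-1) 0) => [|y /(parallelepiped_coord _ fv)/(_ k)/andP[]]; first lra.
    by rewrite -/N; lra.
  apply: (out 1 (-1)) => [|y /(parallelepiped_coord _ fv)/(_ k)/andP[]]; first lra.
  by rewrite -/N; lra.
have : nbhs x [set y : V | forall k, 0 < (y *m N) 0 k < 1].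
  apply: (@filter_forall _ _ (fun k (y : V) => 0 < (y *m N) 0 k < 1) _
    (nbhs_filter x)) => k; have /andP[h0 h1] := in01 k.
  have [|r r0 hr] := @near_mulmx_pos N k 0 1 x _; first lra.
  have [|s s0 hs] := @near_mulmx_pos N k 1 (-1) x _; first lra.
  apply/nbhs_normP; exists (Num.min r s); first by rewrite lt_min r0.
  move=> y; rewrite lt_min => /andP[/hr ? /hs ?].
  by apply/andP; split; lra.
apply: filterS => y hy; apply/(parallelepiped_coord _ fv) => k.
by have /andP[/ltW -> ->] := hy k.
Qed.

End parallelepiped_boundary.

(** * Bounded discrepancy of parallelepipeds *)

Lemma chi_le_subset (R : realType) d (S T : set 'rV[R]_d) x :
  bounded_set T -> S `<=` T -> chi S x <= chi T x.
Proof.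
move=> bT ST; have bS : bounded_set S.
  apply/bounded_setP; have [K K0 TK] := (bounded_setP _).1 bT.
  by exists K => // y /ST/TK.
rewrite !chi_card// ler_nat; apply/fsubset_leq_card/fsubsetP => k.
rewrite !in_fset_set; [|exact: finite_hits|exact: finite_hits].
by move=> /set_mem/ST h; apply/mem_set.
Qed.

Section average.
Context (R : realType) (d : nat) (alpha : 'rV[R]_d) (u : 'rV[R]_d -> R) (C : R).
Hypothesis osc : forall x y n, `|birkhoff alpha u n x - birkhoff alpha u n y| <= C.

Lemma birkhoffM n m x :
  birkhoff alpha u (n * m) x = \sum_(0 <= j < m) birkhoff alpha u n (x + alpha *+ (n * j)).
Proof.
elim: m => [|m IH]; first by rewrite muln0 /birkhoff !big_geq.
rewrite big_nat_recr//= -IH /birkhoff mulnS addnC (@big_cat_nat _ _ _ (n * m)%N) ?leq_addr//=.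
congr (_ + _); rewrite -{1}[(n * m)%N]add0n big_addn addnC addnK.
by apply: eq_bigr => k _; rewrite addnC mulrnDr addrA.
Qed.

(** A sum of length n m is a sum of m sums of length n. Therefore the intervals
    with centre a_n / n and radius C / n, where a_n is the sum of length n at 0,
    meet pairwise, and rho is taken in all of them. *)
Lemma exists_average : exists rho, forall x n, `|birkhoff alpha u n x - n%:R * rho| <= C + C.
Proof.
pose a n := birkhoff alpha u n 0.
have C0 : 0 <= C by apply: le_trans (osc 0 0 0%N).
have amul n m : `|a (n * m)%N - m%:R * a n| <= m%:R * C.
  rewrite /a birkhoffM (_ : m%:R * _ = \sum_(0 <= j < m) birkhoff alpha u n 0); last first.
    by rewrite sumr_const_nat subn0 mulr_natl.
  rewrite -sumrB (_ : m%:R * C = \sum_(0 <= j < m) C); last first.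
    by rewrite sumr_const_nat subn0 mulr_natl.
  by apply: le_trans (ler_norm_sum _ _ _) _; apply: ler_sum => j _; exact: osc.
have cmp n m : (0 < n)%N -> (0 < m)%N -> (a n - C) / n%:R <= (a m + C) / m%:R.
  move=> n0 m0; rewrite ler_pdivrMr ?ltr0n// mulrAC ler_pdivlMr ?ltr0n//.
  have := amul n m; have := amul m n; rewrite mulnC !ler_norml.
  by move=> /andP[h1 h2] /andP[h3 h4]; lra.
pose A := [set (a n.+1 - C) / n.+1%:R | n in [set: nat]].
have Aub m : (0 < m)%N -> ubound A ((a m + C) / m%:R).
  by move=> m0 _ [n _ <-]; exact: cmp.
exists (sup A) => x n.
suff h : `|a n - n%:R * sup A| <= C.
  rewrite -(subrK (a n) (birkhoff _ _ _ _)) -addrA.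
  by apply: le_trans (ler_normD _ _) _; apply: lerD => //; exact: osc.
case: n => [|n]; first by rewrite /a /birkhoff big_geq// mul0r subrr normr0.
have n0 : 0 < n.+1%:R :> R by rewrite ltr0n.
have h1 : (a n.+1 - C) / n.+1%:R <= sup A.
  by apply: ub_le_sup; [exists ((a 1%N + C) / 1%:R); exact: Aub|exists n].
have h2 : sup A <= (a n.+1 + C) / n.+1%:R.
  by apply: ge_sup; [exists ((a 1%N - C) / 1%:R), 0%N|exact: Aub].
rewrite ler_pdivrMr// in h1; rewrite ler_pdivlMr// in h2.
by rewrite ler_norml; apply/andP; split; lra.
Qed.

End average.

Section bounded_discrepancy.
Context (R : realType) (n : nat) (alpha : 'rV[R]_n) (v : n.-tuple 'rV[R]_n).
Local Notation V := 'rV[R]_n.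
Local Notation P := (parallelepiped v).
Local Notation iv := (@int_vec R n).
Hypotheses (fv : free v) (vG : forall k, shift_group alpha (tnth v k)).

Let coord (x : V) k := (x *m invmx (row_matrix v)) 0 k.

Let coordB x y k : coord (x - y) k = coord x k - coord y k.
Proof. by rewrite /coord mulmxBl mxE [X in _ + X]mxE. Qed.

Let coord_v s k j : coord (s *: tnth v k) j = s * (k == j)%:R.
Proof.
have uM := fv; rewrite free_row_matrix in uM.
have -> : tnth v k = row k (row_matrix v) by rewrite rowK.
by rewrite /coord -scalemxAl -row_mul mulmxV// row1 !mxE eqxx /= eq_sym.
Qed.

Let PE x : P x <-> forall k, 0 <= coord x k < 1.
Proof. exact: parallelepiped_coord. Qed.

(** The slab D leaves the parallelepiped on one side when it is moved by s v_k, and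
    D + v_k enters on the other side. *)
Let chi_move k s x : 0 <= s < 1 -> let D := P `&` [set y | coord y k < s] in
  chi P (x - s *: tnth v k) + chi D x = chi P x + chi D (x - tnth v k).
Proof.
move=> /andP[s0 s1] D; rewrite -!chi_translate !chiE.
have [K1 _ PK] := (bounded_setP _).1 (bounded_parallelepiped v).
have tK w (A : set V) y : A `<=` P -> translate w A y -> `|y| <= K1 + `|w|.
  move=> AP [z /AP/PK zK <-].
  by apply: le_trans (ler_normD _ _) _; rewrite lerD2r.
pose K := K1 + `|s *: tnth v k| + `|tnth v k|.
have K1K : K1 <= K by rewrite /K -addrA lerDl addr_ge0.
have sA (A : set V) : A `<=` P -> supported K (\1_A : V -> R).
  by move=> AP; apply: supported_indic => y /AP/PK; move/le_trans; exact.
have sP w : K1 + `|w| <= K -> forall A, A `<=` P -> supported K (\1_(translate w A) : V -> R).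
  move=> wK A AP; apply: supported_indic => y Ay; exact: le_trans (tK w A y AP Ay) wK.
have subD : D `<=` P by move=> y [].
have s1P : supported K (\1_(translate (s *: tnth v k) P) : V -> R).
  by apply: sP => //; rewrite /K lerDl.
have s2P : supported K (\1_(translate (tnth v k) D) : V -> R).
  by apply: sP => //; rewrite /K addrAC lerDl.
rewrite -(periodizeD x s1P (sA _ subD)) -(periodizeD x (sA _ (@subset_refl _ _)) s2P).
apply: eq_periodize => m /=; move: (x + iv m) => y; rewrite !indicE.
have dP (w : V) (A : set V) : (y \in translate w A) = (y - w \in A).
  by apply: asbool_equiv_eq; rewrite translateE.
rewrite !dP.
have [Q|nQ] := pselect (forall j, j != k -> 0 <= coord y j < 1); last first.
  have out r : coord y k = coord y k -> forall A, A `<=` P -> (y - r *: tnth v k \in A) = false.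
    move=> _ A AP; apply/negbTE/negP => /set_mem/AP/PE h; apply: nQ => j jk.
    by have := h j; rewrite coordB coord_v eq_sym (negbTE jk) mulr0 subr0.
  have out0 A : A `<=` P -> (y \in A) = false.
    by move=> AP; have := out 0 erefl A AP; rewrite scale0r subr0.
  by rewrite !out0// out// -[tnth v k]scale1r out.
have inP r : (y - r *: tnth v k \in P) = (0 <= coord y k - r < 1).
  apply/idP/idP => [/set_mem/PE/(_ k)|h]; first by rewrite coordB coord_v eqxx mulr1.
  apply/mem_set/PE => j; rewrite coordB coord_v; have [<-|jk] := eqVneq k j.
    by rewrite mulr1.
  by rewrite mulr0 subr0; apply: Q; rewrite eq_sym.
have inD r : (y - r *: tnth v k \in D) = (0 <= coord y k - r < s).
  apply/idP/idP => [/set_mem[/mem_set]|/andP[h1 h2]].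
    rewrite inP => /andP[h1 _] /=; rewrite coordB coord_v eqxx mulr1 => h2.
    by rewrite h1.
  apply/mem_set; split; last by rewrite /= coordB coord_v eqxx mulr1.
  by apply/set_mem; rewrite inP h1 /=; lra.
have := inP 0; have := inD 0; have := inD 1; rewrite scale1r scale0r !subr0 => -> -> ->.
rewrite inP; set t := coord y k.
have neg (a b : R) : b < a -> (a <= b) = false by move=> ab; rewrite leNgt ab.
case: (ltP t 0) => t0 /=.
  have -> : (0 <= t - s) = false by apply: neg; lra.
  by have -> : (0 <= t - 1) = false by apply: neg; lra.
case: (ltP t s) => ts.
  have -> : (0 <= t - s) = false by apply: neg; lra.
  have -> : (0 <= t - 1) = false by apply: neg; lra.
  have -> : t < 1 by lra.
  by rewrite addr0 add0r.
have -> : 0 <= t - s by lra.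
case: (ltP t 1) => t1 /=.
  have -> : (0 <= t - 1) = false by apply: neg; lra.
  by have -> : t - s < 1 by lra.
have -> : 0 <= t - 1 by lra.
have -> : (t - s < 1) = (t - 1 < s) by apply/idP/idP => ?; lra.
by rewrite addr0 add0r.
Qed.

(** By [chi_move] and [birkhoff_shift_le], the Birkhoff sums at x - s v_k and at x
    differ by a bound that depends on s, but neither on x nor on the length. Every
    point is congruent modulo Z^d to a point with bounded coordinates in the basis
    of the edges, and can thus be moved to 0 at bounded cost. *)
Lemma parallelepiped_discrepancy :
  exists rho C : R, forall x N, `|birkhoff alpha (chi P) N x - N%:R * rho| <= C.
Proof.
have [M M0 chiM] := chi_le (bounded_parallelepiped v).
have [nn hn] := boolp.choice vG; have [mm vE] := boolp.choice hn => {hn}.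
pose c k := (absz (nn k))%:R * M.
have c0 k : 0 <= c k by rewrite mulr_ge0.
have unit_move k s x N : 0 <= s < 1 ->
    `|birkhoff alpha (chi P) N (x - s *: tnth v k) - birkhoff alpha (chi P) N x| <= c k.
  move=> s01; pose D := P `&` [set y | coord y k < s].
  have -> : birkhoff alpha (chi P) N (x - s *: tnth v k) - birkhoff alpha (chi P) N x =
    birkhoff alpha (chi D) N (x - tnth v k) - birkhoff alpha (chi D) N x.
    rewrite /birkhoff -!sumrB; apply: eq_bigr => i _.
    have /= := chi_move k (x + alpha *+ i) s01; rewrite -/D.
    rewrite ![x - _ + _]addrAC; lra.
  apply: birkhoff_shift_le (vE k); first exact: chi_int_periodic.
  move=> y; rewrite chi_ge0/=; apply: le_trans (chiM y).
  by apply: chi_le_subset; [exact: bounded_parallelepiped|move=> ? []].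
have move1 k s x N :
    `|birkhoff alpha (chi P) N (x - s *: tnth v k) - birkhoff alpha (chi P) N x| <=
      (`|s| + 2) * c k.
  pose j := Num.floor s; have f1 := floor_le s; have f2 := floorD1_gt s.
  rewrite -/j intrD in f1 f2.
  have -> : x - s *: tnth v k = (x - (s - j%:~R) *: tnth v k) - tnth v k *~ j.
    have {1}-> : s *: tnth v k = (s - j%:~R) *: tnth v k + tnth v k *~ j.
      by rewrite -[tnth v k *~ j]scaler_int -scalerDl subrK.
    by rewrite opprD addrA.
  set x' := x - _; rewrite -(subrK (birkhoff alpha (chi P) N x') (birkhoff _ _ _ _)) -addrA.
  apply: le_trans (ler_normD _ _) _.
  apply: (@le_trans _ _ ((`|s| + 1) * c k + c k)); last lra.
  apply: lerD; last by apply: unit_move; apply/andP; split; lra.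
  apply: (@le_trans _ _ ((absz (nn k * j))%:R * M)).
    apply: (@birkhoff_shift_le _ _ _ _ _ _ _ _ _ (mm k *~ j)).
    - exact: chi_int_periodic.
    - by move=> y; rewrite chi_ge0 chiM.
    - by rewrite vE mulrzDl mulrzA int_vecMz.
  rewrite abszM natrM /c mulrA ler_wpM2r// mulrC ler_wpM2r//.
  rewrite natr_absz intr_norm ler_norml.
  have := ler_norm s; have := ler_norm (- s); rewrite normrN => *.
  by apply/andP; split; lra.
pose S k := \sum_i `|invmx (row_matrix v) i k|.
pose C1 := \sum_k (S k + 2) * c k.
have osc0 x N : `|birkhoff alpha (chi P) N x - birkhoff alpha (chi P) N 0| <= C1.
  pose m : 'rV[int]_n := \row_i - Num.floor (x 0 i).
  have -> : birkhoff alpha (chi P) N x = birkhoff alpha (chi P) N (x + iv m).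
    by apply: eq_bigr => i _; rewrite addrAC chi_int_periodic.
  set y := x + iv m.
  have y1 : `|y| <= 1.
    apply/norm_rV_le => // i; rewrite !mxE intrN ler_norml.
    have := floor_le (x 0 i); have := floorD1_gt (x 0 i); rewrite intrD => ? ?.
    by apply/andP; split; lra.
  have many (r : seq 'I_n) z : `|birkhoff alpha (chi P) N (z - \sum_(k <- r) coord y k *: tnth v k)
      - birkhoff alpha (chi P) N z| <= \sum_(k <- r) (`|coord y k| + 2) * c k.
    elim: r z => [z|k r IH z]; first by rewrite !big_nil subr0 subrr normr0.
    rewrite !big_cons opprD addrA; set z' := z - _.
    rewrite -(subrK (birkhoff alpha (chi P) N z') (birkhoff _ _ _ _)) -addrA.
    apply: le_trans (ler_normD _ _) _; rewrite [leRHS]addrC.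
    by apply: lerD; [exact: IH|exact: move1].
  have yE : y = \sum_k coord y k *: tnth v k.
    have uM := fv; rewrite free_row_matrix in uM.
    rewrite -[LHS](mulmxKV uM) mulmx_sum_row; apply: eq_bigr => k _.
    by rewrite rowK.
  have := many (index_enum 'I_n) y; rewrite -yE subrr distrC => /le_trans; apply.
  apply: ler_sum => k _; rewrite ler_wpM2r// lerD2r.
  apply: le_trans (norm_mulmx_le _ _ _) _; rewrite -[leRHS]mul1r ler_wpM2r//.
  exact: sumr_ge0.
have [rho h] : exists rho, forall x N,
    `|birkhoff alpha (chi P) N x - N%:R * rho| <= (C1 + C1) + (C1 + C1).
  apply: exists_average => x y N.
  rewrite -(subrK (birkhoff alpha (chi P) N 0) (birkhoff _ _ _ x)) -addrA.
  apply: le_trans (ler_normD _ _) _; apply: lerD; first exact: osc0.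
  by rewrite distrC; exact: osc0.
by exists rho, (C1 + C1 + (C1 + C1)).
Qed.

End bounded_discrepancy.

(** * A parallelepiped of given density *)

Lemma map_int_rV (R : realType) d (k : 'rV[int]_d) (A : 'M[int]_d) :
  int_vec R k *m map_mx intr A = int_vec R (k *m A).
Proof. by rewrite /int_vec map_mxM. Qed.

Lemma chi_unimodular (R : realType) d (A : 'M[int]_d) (S : set 'rV[R]_d) x :
  A \in unitmx ->
  chi [set y | S (y *m map_mx intr A)] x = chi S (x *m map_mx intr A).
Proof.
move=> uA; rewrite [RHS]/chi (reindex_fsbigT (mulmx^~ A)); last first.
  by exists (mulmx^~ (invmx A)) => k; rewrite ?mulmxK ?mulmxKV.
apply: eq_fsbigr => k _; rewrite !indicE -map_int_rV -mulmxDl.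
by congr (nat_of_bool _)%:R; apply: asbool_equiv_eq.
Qed.

Section sheared_slab.
Context (R : realType) (d : nat) (c : 'I_d.+1 -> R) (mu : R).
Hypothesis mu0 : 0 <= mu.
Local Notation V := 'rV[R]_d.+1.

(** The coordinates other than the first run through half-open unit intervals, and
    therefore do not influence the count modulo Z^d. *)
Definition sheared_slab : set V := [set y | 0 <= y 0 ord0 < mu /\
  forall j, j != ord0 -> 0 <= y 0 j - y 0 ord0 * c j < 1].

Lemma chi_sheared_slab y :
  chi sheared_slab y = (Num.floor (y 0 ord0))%:~R - (Num.floor (y 0 ord0 - mu))%:~R.
Proof.
set b := Num.floor (y 0 ord0); set a := Num.floor (y 0 ord0 - mu).
have ab : a <= b by apply: le_floor; rewrite gerBl.
pose N := absz (b - a).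
have NE : N%:Z = b - a by rewrite /N; lia.
pose s (i : nat) : int := - b + i%:Z.
pose h (i : nat) : 'rV[int]_d.+1 := \row_j
  (if j == ord0 then s i
   else - Num.floor (y 0 j - (y 0 ord0 + (s i)%:~R) * c j)).
rewrite -intrB -NE -pmulrn; apply: (@chi_bij _ _ _ _ _ h).
have b1 := floor_le (y 0 ord0); have b2 := floorD1_gt (y 0 ord0).
have a1 := floor_le (y 0 ord0 - mu); have a2 := floorD1_gt (y 0 ord0 - mu).
rewrite -/a -/b !intrD in b1 b2 a1 a2.
split.
- move=> i /= iN; split=> [|j j0]; rewrite !mxE ?eqxx.
    have i0 : (0%:~R : R) <= (i%:Z)%:~R by rewrite ler_int.
    have i1 : (i%:Z + 1)%:~R <= (b - a)%:~R :> R by rewrite ler_int; lia.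
    move: i0 i1; rewrite /s !intrD !intrN => i0 i1.
    by apply/andP; split; lra.
  rewrite (negbTE j0); set z := (_ + _) * c j.
  have := floor_le (y 0 j - z); have := floorD1_gt (y 0 j - z).
  by rewrite intrD intrN => ? ?; apply/andP; split; lra.
- move=> i k _ _ /rowP/(_ ord0); rewrite !mxE eqxx /s => /addrI; lia.
move=> k [/= k0 kj]; rewrite !mxE in k0; have /andP[k1 k2] := k0.
exists (absz (k 0 ord0 + b)).
  have h1 : (0%:~R : R) < (k 0 ord0 + b + 1)%:~R by rewrite !intrD; lra.
  have h2 : (k 0 ord0 + b)%:~R < (b - a)%:~R :> R by rewrite intrD intrB; lra.
  by move: h1 h2; rewrite !ltr_int /N => ? ?; rewrite /=; lia.
have sE : s (absz (k 0 ord0 + b)) = k 0 ord0.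
  have h1 : (0%:~R : R) < (k 0 ord0 + b + 1)%:~R by rewrite !intrD; lra.
  by move: h1; rewrite ltr_int /s; lia.
apply/rowP => j; rewrite mxE sE; case: eqVneq => [->//|j0].
have := kj j j0; rewrite !mxE => /andP[h1 h2].
apply/eqP; rewrite eqr_oppLR; apply/eqP/floor_def.
by rewrite intrD intrN; apply/andP; split; lra.
Qed.

End sheared_slab.

(** By the Smith normal form, p is g times the first row of a unimodular matrix A.
    In the coordinates x A^T, put beta = alpha A^T: then mu = p0 + g beta_0, and the
    vectors p0 e_0 + g beta, e_1, ..., e_d span a sheared slab of height mu. Its
    counting function at a point with first coordinate y is
    floor y - floor (y - mu) = mu + {y - g beta_0} - {y}. Here {y} is the fractional
    part, so the Birkhoff sums of the difference with mu telescope. *)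
Lemma parallelepiped_of_density (R : realType) (d : nat) (alpha : 'rV[R]_d.+1)
    (mu : R) (p0 : int) (p : 'I_d.+1 -> int) :
  0 < mu -> mu = p0%:~R + \sum_i (p i)%:~R * alpha 0 i ->
  exists v : (d.+1).-tuple 'rV[R]_d.+1,
    [/\ free v, forall k, shift_group alpha (tnth v k) &
      exists C : R, forall x n,
        `|birkhoff alpha (chi (parallelepiped v)) n x - n%:R * mu| <= C].
Proof.
move=> mu0 muE.
have [L uL [A uA [s _ pE]]] := int_Smith_normal_form (\row_i p i).
pose g := L 0 0 * s`_0.
have {}pE i : p i = g * A ord0 i.
  have := congr1 (fun M : 'rV_d.+1 => M 0 i) pE; rewrite !mxE => ->.
  rewrite big_ord_recl big1 ?addr0 => [|j _].
    by rewrite !mxE big_ord_recl big_ord0 addr0 !mxE eqxx mulr1n.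
  by rewrite !mxE big_ord_recl big_ord0 addr0 !mxE /= mulr0n mulr0 mul0r.
pose Q : 'M[R]_d.+1 := map_mx intr A^T.
have uAT : A^T \in unitmx by rewrite unitmx_tr.
pose Qi : 'M[R]_d.+1 := map_mx intr (invmx A^T).
have QQi : Q *m Qi = 1%:M by rewrite /Q /Qi -map_mxM mulmxV// map_mx1.
have QiQ : Qi *m Q = 1%:M by rewrite /Q /Qi -map_mxM mulVmx// map_mx1.
pose beta := alpha *m Q.
have beta0 : mu = p0%:~R + g%:~R * beta 0 ord0.
  rewrite muE /beta mxE mulr_sumr; congr (_ + _); apply: eq_bigr => i _.
  by rewrite pE !mxE intrM -mulrA; congr (_ * _); rewrite mulrC.
pose T : 'M[R]_d.+1 := \matrix_(i, j)
  (if i == ord0 then (if j == ord0 then p0%:~R else 0) + g%:~R * beta 0 j else (i == j)%:R).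
have T00 : T ord0 ord0 = mu by rewrite mxE !eqxx beta0.
have tT0 (t : 'rV[R]_d.+1) : (t *m T) 0 ord0 = t 0 ord0 * mu.
  rewrite mxE big_ord_recl T00 big1 ?addr0// => j _.
  by rewrite mxE /= mulr0.
have T0j j : j != ord0 -> T ord0 j = g%:~R * beta 0 j.
  by move=> /negbTE j0; rewrite mxE eqxx j0 add0r.
have Tij i j : i != ord0 -> T i j = (i == j)%:R.
  by move=> /negbTE i0; rewrite mxE i0.
have tTj (t : 'rV[R]_d.+1) j : j != ord0 ->
    (t *m T) 0 j = t 0 ord0 * (g%:~R * beta 0 j) + t 0 j.
  move=> j0; rewrite mxE (bigD1 ord0)//= (bigD1 j)//= T0j// Tij// eqxx mulr1.
  rewrite big1 ?addr0// => i /andP[i0 ij].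
  by rewrite Tij// (negbTE ij) mulr0.
pose M := T *m Qi; pose v : (d.+1).-tuple 'rV[R]_d.+1 := [tuple row k M | k < d.+1].
have vM : row_matrix v = M by apply/row_matrixP => i; rewrite rowK tnth_mktuple.
have Pslab x : parallelepiped v x <->
    sheared_slab (fun j => mu^-1 * (g%:~R * beta 0 j)) mu (x *m Q).
  rewrite parallelepiped_mulmx vM; split=> [[t ht ->]|[h0 hj]].
    rewrite /M mulmxA -[_ *m Q]mulmxA QiQ mulmx1; split.
      have /andP[t0 t1] := ht ord0.
      by rewrite tT0 mulr_ge0 ?(ltW mu0)//= gtr_pMl.
    move=> j j0; rewrite tT0 tTj// (_ : _ - _ = t 0 j)//.
    by field; rewrite gt_eqF.
  pose t : 'rV[R]_d.+1 := \row_j (if j == ord0 then (x *m Q) 0 ord0 / mu else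
     (x *m Q) 0 j - (x *m Q) 0 ord0 * (mu^-1 * (g%:~R * beta 0 j))).
  have xQ : x *m Q = t *m T.
    apply/rowP => j; have [->|j0] := eqVneq j ord0.
      by rewrite tT0 [t _ _]mxE eqxx mulfVK// gt_eqF.
    rewrite tTj// [t _ ord0]mxE eqxx [t _ j]mxE (negbTE j0) mulrA; ring.
  exists t; last by rewrite /M mulmxA -xQ -mulmxA QQi mulmx1.
  move=> k; rewrite mxE; case: eqVneq => [_|k0]; last exact: hj.
  have /andP[h1 h2] := h0.
  by rewrite divr_ge0 ?(ltW mu0)//= ltr_pdivrMr// mul1r.
exists v; split.
- rewrite free_row_matrix vM /M unitmx_mul; apply/andP; split; last first.
    by have [] := mulmx1_unit QiQ.
  rewrite -row_free_unit; apply/inj_row_free => t t0.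
  have t00 : t 0 ord0 = 0.
    have := tT0 t; rewrite t0 mxE => /esym/eqP.
    by rewrite mulf_eq0 (gt_eqF mu0) orbF => /eqP.
  apply/rowP => j; rewrite mxE; have [->//|j0] := eqVneq j ord0.
  by have := tTj t j j0; rewrite t0 mxE t00 mul0r add0r.
- move=> k; rewrite tnth_mktuple row_mul.
  pose e : 'rV[int]_d.+1 := if k == ord0 then p0 *: delta_mx 0 ord0 else delta_mx 0 k.
  exists (if k == ord0 then g else 0), (e *m invmx A^T).
  rewrite -map_int_rV -/Qi.
  have -> : row k T = (if k == ord0 then g else 0)%:~R *: beta + int_vec R e.
    apply/rowP => j; rewrite [LHS]mxE [LHS]mxE [RHS]mxE [X in _ = X + _]mxE int_vecE.
    rewrite /e; case: ifP => k0; rewrite !mxE.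
      by case: ifP => j0; rewrite ?mulr1 ?mulr0 ?addr0 ?add0r// addrC.
    by rewrite mul0r add0r eq_sym mulrz_nat.
  by rewrite mulmxDl -scalemxAl /beta -mulmxA QQi mulmx1 scaler_int.
pose fr (y : R) := y - (Num.floor y)%:~R.
have fr01 y : 0 <= fr y <= 1.
  have := floor_le y; have := floorD1_gt y; rewrite intrD /fr => ? ?.
  by apply/andP; split; lra.
have frint y (m : int) : fr (y + m%:~R) = fr y.
  by rewrite /fr floorDrz ?intr_int// intrKfloor intrD; ring.
pose u (x : 'rV[R]_d.+1) := fr ((x *m Q) 0 ord0).
have uper : int_periodic u.
  by move=> x m; rewrite /u mulmxDl map_int_rV mxE int_vecE frint.
have chiE x : chi (parallelepiped v) x = u (x - alpha *~ g) - u x + mu.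
  have -> : parallelepiped v = [set x | sheared_slab
      (fun j => mu^-1 * (g%:~R * beta 0 j)) mu (x *m Q)].
    by apply/seteqP; split=> y /Pslab.
  rewrite chi_unimodular// chi_sheared_slab ?ltW// -/Q /u.
  have -> : ((x - alpha *~ g) *m Q) 0 ord0 = (x *m Q) 0 ord0 - mu + p0%:~R.
    rewrite mulmxBl mxE [X in _ + X]mxE -scaler_int -scalemxAl -/beta.
    by rewrite [X in _ - X]mxE beta0; ring.
  rewrite frint /fr; ring.
exists ((absz g)%:R * 1) => x n.
have <- : birkhoff alpha u n (x - alpha *~ g) - birkhoff alpha u n x =
    birkhoff alpha (chi (parallelepiped v)) n x - n%:R * mu.
  rewrite /birkhoff; under [X in _ = X - _]eq_bigr do rewrite chiE.
  rewrite [X in _ = X - _]big_split /= [X in _ = X + _ - _]sumrB.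
  rewrite sumr_const_nat subn0 mulr_natl addrK.
  by congr (_ - _); apply: eq_bigr => k _; rewrite addrAC.
apply: (@birkhoff_shift_le _ _ _ u 1 n x _ g 0) => // [y|]; first exact: fr01.
by rewrite int_vec0 addr0.
Qed.

(** * Ranks along an orbit *)

Lemma finite_rank (R : realType) (T : choiceType) (A : {fset T}) (key : T -> R) :
  {in A &, injective key} ->
  let rk k := #|` [fset l in A | key l < key k]%fset| in
  (forall k, k \in A -> (rk k < #|` A|)%N) /\ {in A &, injective rk} /\
  forall i, (i < #|` A|)%N -> exists2 k, k \in A & rk k = i.
Proof.
move=> inj rk.
have rk_lt k l : k \in A -> l \in A -> key k < key l -> (rk k < rk l)%N.
  move=> kA lA kl; apply: fproper_ltn_card; rewrite fproperE; apply/andP; split.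
    by apply/fsubsetP => m; rewrite !inE => /andP[-> /= mk]; apply: lt_trans mk kl.
  by apply/fsubsetPn; exists k; rewrite !inE ?kA ?ltxx.
have rkA k : k \in A -> (rk k < #|` A|)%N.
  move=> kA; apply: fproper_ltn_card; rewrite fproperE; apply/andP; split.
    by apply/fsubsetP => m; rewrite !inE => /andP[].
  by apply/fsubsetPn; exists k; rewrite // !inE ltxx andbF.
have rk_inj : {in A &, injective rk}.
  move=> k l kA lA e; apply: inj => //.
  case: (ltgtP (key k) (key l)) => // kl.
    by have := rk_lt k l kA lA kl; rewrite e ltnn.
  by have := rk_lt l k lA kA kl; rewrite e ltnn.
split=> //; split=> // i iA.
have sz : size [seq rk k | k <- A] = #|` A| by rewrite size_map.
have [|||_ E] := @uniq_min_size _ [seq rk k | k <- A] (iota 0 #|` A|).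
- by rewrite map_inj_in_uniq ?fset_uniq.
- by move=> _ /mapP[k kA ->]; rewrite mem_iota add0n /= rkA.
- by rewrite size_iota sz.
have : i \in [seq rk k | k <- A] by rewrite E mem_iota.
by move=> /mapP[k kA ->]; exists k.
Qed.

Section hits_off_boundary.
Context (R : realType) (d : nat).
Local Notation V := 'rV[R]_d.
Local Notation iv := (@int_vec R d).
Implicit Types (S : set V) (x y : V).

Lemma not_boundary_near S x : ~ boundary S x ->
  exists2 r, 0 < r & forall y, `|y - x| < r -> (S y <-> S x).
Proof.
move=> nb; have [cS|ncS] := pselect (closure S x).
  have /nbhs_normP[r r0 rS] : interior S x by apply: contrapT => nS; exact: nb.
  exists r => // y yx; split=> _; last exact: rS.
  by apply: rS; rewrite subrr normr0.
have [r r0 hr] : exists2 r, 0 < r & forall y, `|y - x| < r -> ~ S y.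
  move: ncS => /closureP => /existsNP[r] /not_implyP[r0 h]; exists r => // y yx Sy.
  by apply: h; exists y.
exists r => // y yx; split=> h; exfalso; first exact: hr yx h.
by apply: ncS; exact: subset_closure.
Qed.

(** Only finitely many translates of x come near the bounded set S, so finitely
    many conditions of [not_boundary_near] have to be met together. *)
Lemma hits_locally_constant S x : bounded_set S ->
  (forall k, ~ boundary S (x + iv k)) ->
  exists2 r, 0 < r & forall y, `|y - x| < r -> hits S y = hits S x.
Proof.
move=> /bounded_setP[K K0 SK] nb.
pose W := fset_set [set k | `|x + iv k| <= K + 1].
have nW k : nbhs x [set y : V | S (y + iv k) <-> S (x + iv k)].
  have [r r0 h] := not_boundary_near (nb k); apply/nbhs_normP; exists r => // y yx.
  by apply: h; rewrite opprD addrACA subrr addr0.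
have : nbhs x (\bigcap_(k in [set` W]) [set y : V | S (y + iv k) <-> S (x + iv k)]).
  by apply: filter_bigI => k _.
move=> /nbhs_normP[r r0 hr]; exists (Num.min r 1); first by rewrite lt_min r0 ltr01.
move=> y; rewrite lt_min => /andP[yr y1].
have [kW|] := pselect (forall k, `|x + iv k| <= K + 1 -> (S (y + iv k) <-> S (x + iv k))).
  apply/seteqP; split=> k Sk.
    apply/(kW k) => //; have -> : x + iv k = (y + iv k) - (y - x).
      by rewrite opprB [RHS]addrC addrA subrK.
    apply: le_trans (ler_normB _ _) _; apply: lerD; [exact: SK|exact: ltW].
  apply/(kW k) => //; apply: le_trans (SK _ Sk) _; by rewrite lerDl.
case=> k kK; apply: (hr y yr k); rewrite /= /W in_fset_set; last exact: finite_window.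
exact/mem_set.
Qed.

Lemma hits_locally_constant_off (alpha : V) E S : orbit_invariant alpha E ->
  bounded_set S -> (forall x, ~ E x -> ~ boundary S x) ->
  forall x, ~ E x -> exists2 r, 0 < r & forall y, `|y - x| < r -> hits S y = hits S x.
Proof.
move=> E_inv bS ES x nE; apply: hits_locally_constant => // k; apply: ES.
by have := orbit_invariantN (n := 0) (m := k) E_inv nE; rewrite mulr0z add0r.
Qed.

Lemma chi_locally_constant_off (alpha : V) E S : orbit_invariant alpha E ->
  bounded_set S -> (forall x, ~ E x -> ~ boundary S x) ->
  locally_constant_off E (chi S).
Proof.
move=> E_inv bS ES x /(hits_locally_constant_off E_inv bS ES)[r r0 h].
by exists r => // y /h hy; rewrite !chi_card// hy.
Qed.

End hits_off_boundary.

Section rank.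
Context (R : realType) (d : nat) (alpha : 'rV[R]_d).
Local Notation V := 'rV[R]_d.
Local Notation iv := (@int_vec R d).
Local Notation orb n k := (alpha *~ n + iv k).
Hypothesis irr : irrational_vector alpha.

(** The points of one orbit at the same time form a coset of Z^d. They are ordered
    by this linear form, which is injective since alpha is irrational. *)
Definition key (k : 'rV[int]_d) : R := \sum_i (k 0 i)%:~R * alpha 0 i.

Lemma keyB k l : key (k - l) = key k - key l.
Proof.
rewrite /key -sumrB; apply: eq_bigr => i _.
by rewrite !mxE intrB mulrBl.
Qed.

Lemma key_inj : injective key.
Proof.
move=> k l /eqP; rewrite -subr_eq0 -keyB => /eqP e.
have [|_ h] := irrational_int_independent irr (c0 := 0) (c := (k - l) 0).
  by rewrite add0r.
by apply/eqP; rewrite -subr_eq0; apply/eqP/rowP => i; rewrite h mxE.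
Qed.

(** The rank of y among the points of S in the coset y + Z^d. *)
Definition idx (S : set V) (y : V) : nat :=
  #|` fset_set (hits S y `&` [set k | key k < 0])|.

Lemma hits_shift S y k : hits S (y + iv k) = (fun l => k + l) @^-1` hits S y.
Proof. by apply/seteqP; split=> l; rewrite /hits /= int_vecD addrA. Qed.

Lemma idx_slice S y k : bounded_set S ->
  idx S (y + iv k) = #|` [fset l in fset_set (hits S y) | key l < key k]%fset|.
Proof.
move=> bS; have fy := finite_hits y bS; have fyk := finite_hits (y + iv k) bS.
rewrite /idx; set X := fset_set _.
have <- : #|` [fset (k + m)%R | m in X]%fset| = #|` X|.
  by rewrite card_imfset//; exact: addrI.
congr (size (enum_fset _)); apply/fsetP => l; rewrite /X {X}.
rewrite !inE /=; apply/imfsetP/andP => [[m /= + ->]|[+ lk]].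
  rewrite in_fset_set; last exact: finite_setIl.
  move=> /set_mem[hm /= m0]; split.
    by rewrite in_fset_set//; apply/mem_set; move: hm; rewrite hits_shift.
  by rewrite -subr_lt0 -keyB addrC addKr.
rewrite in_fset_set// => /set_mem hl; exists (l - k) => /=; last by rewrite addrC subrK.
rewrite in_fset_set; last exact: finite_setIl.
apply/mem_set; split; last by rewrite /= keyB subr_lt0.
by rewrite hits_shift /= addrC subrK.
Qed.

Lemma slice_rank S y : bounded_set S ->
  (forall k, hits S y k -> (idx S (y + iv k))%:R < chi S y) /\
  (forall k l, hits S y k -> hits S y l -> idx S (y + iv k) = idx S (y + iv l) -> k = l) /\
  (forall i, i%:R < chi S y -> exists2 k, hits S y k & idx S (y + iv k) = i).
Proof.
move=> bS; have fy := finite_hits y bS.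
have kE k : (k \in fset_set (hits S y)) = (k \in hits S y) by rewrite in_fset_set.
have [h1 [h2 h3]] := finite_rank (A := fset_set (hits S y)) (key := key) (in2W key_inj).
split; [|split].
- by move=> k hk; rewrite chi_card// ltr_nat idx_slice//; apply: h1; rewrite kE; exact/mem_set.
- by move=> k l hk hl; rewrite !idx_slice//; apply: h2; rewrite kE; exact/mem_set.
move=> i; rewrite chi_card// ltr_nat => /h3[k]; rewrite kE => /set_mem hk e.
by exists k => //; rewrite idx_slice.
Qed.

Lemma eq_idx S y z : hits S y = hits S z -> idx S y = idx S z.
Proof. by rewrite /idx => ->. Qed.

Variables (E S : set V) (mu C : R) (g : V -> R).
Hypotheses (E_inv : orbit_invariant alpha E) (bS : bounded_set S) (mu0 : 0 < mu).
Hypotheses (g_per : int_periodic g) (g_bnd : forall x, ~ E x -> `|g x| <= C).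
Hypothesis g_coc : forall x, ~ E x -> g (x + alpha) = g x - (chi S x - mu).

Let nE_orb x n : ~ E x -> ~ E (x + alpha *~ n).
Proof.
by move=> nE; have := orbit_invariantN (n := n) (m := 0) E_inv nE; rewrite int_vec0 addr0.
Qed.

(** Up to an additive constant, the number of points of S on the orbit of x before
    time n. *)
Let level x (n : int) : R := n%:~R * mu - g (x + alpha *~ n).

Let levelS x n : ~ E x -> level x (n + 1) = level x n + chi S (x + alpha *~ n).
Proof.
move=> nE; rewrite /level [alpha *~ _]mulrzDr mulr1z addrA g_coc; last exact: nE_orb.
by rewrite intrD; ring.
Qed.

Let levelD x n (i : nat) : ~ E x -> exists c : nat, level x (n + i%:Z) = level x n + c%:R.
Proof.
move=> nE; elim: i => [|i [c IH]]; first by exists 0%N; rewrite !addr0.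
exists (c + #|` fset_set (hits S (x + alpha *~ (n + i%:Z)))|)%N.
by rewrite -addn1 PoszD addrA levelS// IH natrD addrA chi_card.
Qed.

Lemma transfer_orbit x n k : ~ E x ->
  exists z : int, g (x + orb n k) = g x + n%:~R * mu + z%:~R.
Proof.
move=> nE; rewrite addrA g_per.
have [c hc] : exists c : int, level x n = level x 0 + c%:~R.
  case: n => n.
    by have [c hc] := levelD 0 n nE; exists c; rewrite -hc add0r.
  have [c hc] := levelD (Negz n) n.+1 nE; exists (- c%:Z).
  by rewrite intrN; move: hc; rewrite NegzE addNr => ->; rewrite addrK.
exists (- c); rewrite intrN; move: hc; rewrite /level mul0r mulr0z addr0 sub0r; lra.
Qed.

(** The level grows by the number of points of S at each time, and it is unbounded
    in both directions because g is bounded and mu is positive. So v lies in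
    exactly one of the intervals between consecutive levels; [idx] then enumerates
    the points of S at that time. *)
Lemma rank_bijection x v (z : int) : ~ E x -> v + g x = z%:~R ->
  exists! nk : int * 'rV[int]_d, S (x + orb nk.1 nk.2) /\
    (idx S (x + orb nk.1 nk.2))%:R + nk.1%:~R * mu - g (x + orb nk.1 nk.2) = v.
Proof.
move=> nE vz.
have lev_bnd n : `|level x n - n%:~R * mu| <= C.
  rewrite /level addrAC subrr add0r normrN; apply: g_bnd; exact: nE_orb.
pose B := (Num.truncn ((`|v| + C) / mu)).+1.
have hB : `|v| + C < B%:R * mu by rewrite -ltr_pdivrMr// truncnS_gt.
have lo : level x (- B%:Z) <= v.
  have := lev_bnd (- B%:Z); rewrite intrN -pmulrn ler_norml => /andP[_ h].
  have := ler_norm (- v); rewrite normrN => h'.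
  by move: h; rewrite mulNr; lra.
have hi : v < level x (- B%:Z + (B + B)%N%:Z).
  have -> : - B%:Z + (B + B)%N%:Z = B%:Z by rewrite PoszD addrA addNr add0r.
  have := lev_bnd B; rewrite -pmulrn ler_norml => /andP[h _].
  have := ler_norm v; lra.
have [m hm mmin] : exists2 m : nat, v < level x (- B%:Z + m%:Z) &
    forall i : nat, v < level x (- B%:Z + i%:Z) -> (m <= i)%N.
  have ex : exists i : nat, v < level x (- B%:Z + i%:Z) by exists (B + B)%N.
  by exists (ex_minn ex); case: ex_minnP.
case: m hm mmin => [|m] hm mmin; first by move: hm; rewrite addr0 ltNge lo.
pose n := - B%:Z + m%:Z.
have ln : level x n <= v.
  by rewrite leNgt; apply/negP => /mmin; rewrite ltnn.
have ln1 : v < level x n + chi S (x + alpha *~ n).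
  by rewrite -levelS// /n -addrA -PoszD addn1.
have mono a b : (a <= b)%R -> level x a <= level x b.
  move=> ab; have [c] := levelD a (absz (b - a)) nE.
  have -> : a + `|b - a|%N = b by lia.
  by move=> ->; rewrite lerDl.
have slot a : level x a <= v -> v < level x a + chi S (x + alpha *~ a) -> a = n.
  move=> h1 h2; apply/eqP; rewrite eq_le !leNgt; apply/andP; split; apply/negP => h.
    have : level x (n + 1) <= level x a by apply: mono; rewrite lezD1.
    by rewrite levelS//; lra.
  have : level x (a + 1) <= level x n by apply: mono; rewrite lezD1.
  by rewrite levelS//; lra.
have [c hc] : exists c : nat, v - level x n = c%:R.
  have [e he] : exists e : int, level x n = e%:~R - g x.
    have [e] := transfer_orbit n 0 nE; rewrite int_vec0 addr0 => he.
    by exists (- e); rewrite /level he intrN; ring.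
  have ez : v - level x n = (z - e)%:~R by rewrite he intrB -vz; ring.
  have : (0%:~R : R) <= (z - e)%:~R by rewrite -ez subr_ge0.
  by rewrite ler_int => h; exists (absz (z - e)); rewrite ez -[in LHS](gez0_abs h).
have [_ [inj sur]] := slice_rank (x + alpha *~ n) bS.
have cchi : c%:R < chi S (x + alpha *~ n) by rewrite -hc; lra.
have [k hk ik] := sur c cchi.
exists (n, k); split=> /=.
  rewrite addrA; split; first exact: hk.
  by rewrite ik g_per -hc /level; ring.
move=> [n' k'] /= []; rewrite addrA g_per => hk' e'.
have [lt' [inj' _]] := slice_rank (x + alpha *~ n') bS.
have lt := lt' k' hk'.
have nn' : n' = n.
  apply: slot; rewrite /level; first by rewrite -e' lerBlDr addrAC subrK -addrA lerDr.
  by rewrite -e'; lra.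
subst n'; congr (_, _); apply: inj => //; apply/eqP; rewrite ik -(eqr_nat R) -hc; apply/eqP.
by rewrite -e' /level; ring.
Qed.

End rank.

(** * Matching two sets of equal density *)

Section matching.
Context (R : realType) (d : nat) (alpha : 'rV[R]_d.+1).
Local Notation V := 'rV[R]_d.+1.
Local Notation iv := (@int_vec R d.+1).
Local Notation orb n k := (alpha *~ n + iv k).
Local Notation leb := (@lebesgue_outer R d).
Variables (E S T : set V) (mu C : R).
Hypotheses (irr : irrational_vector alpha) (E_inv : orbit_invariant alpha E)
  (E_null : leb E = 0%E) (mu0 : 0 < mu).
Hypotheses (bS : bounded_set S) (bT : bounded_set T).
Hypotheses (ES : forall x, ~ E x -> ~ boundary S x)
  (ET : forall x, ~ E x -> ~ boundary T x).
Variables (gS gT : V -> R).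
Hypotheses (gS_per : int_periodic gS) (gT_per : int_periodic gT).
Hypotheses (gS_bnd : forall x, ~ E x -> `|gS x| <= C)
  (gT_bnd : forall x, ~ E x -> `|gT x| <= C).
Hypotheses (gS_coc : forall x, ~ E x -> gS (x + alpha) = gS x - (chi S x - mu))
  (gT_coc : forall x, ~ E x -> gT (x + alpha) = gT x - (chi T x - mu)).
Hypotheses (gS_cont : continuous_off E gS) (gT_cont : continuous_off E gT).

Let nE_orb x n k : ~ E x -> ~ E (x + orb n k).
Proof. exact: orbit_invariantN. Qed.

(** Along an orbit gT - gS varies by integers; by continuity and density of orbits,
    it does so everywhere off E. *)
Let difference_integral : exists c, forall x, ~ E x -> exists z : int,
  gT x - gS x + c = z%:~R.
Proof.
have [x0 nE0 _] := null_complement_dense 0 E_null (@ltr01 R).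
exists (gS x0 - gT x0) => x nE.
pose f := gT x - gS x + (gS x0 - gT x0).
exists (Num.floor f); rewrite -/f; apply/eqP; rewrite eq_sym.
have f1 := floor_le f; have f2 := floorD1_gt f; rewrite intrD in f2.
rewrite eq_le f1 /= leNgt; apply/negP => lt.
pose e := Num.min (f - (Num.floor f)%:~R) ((Num.floor f)%:~R + 1 - f) / 2.
have e0 : 0 < e by rewrite divr_gt0// lt_min !subr_gt0 lt.
have e1 : e * 2 <= f - (Num.floor f)%:~R by rewrite divfK// ge_min lexx.
have e2 : e * 2 <= (Num.floor f)%:~R + 1 - f by rewrite divfK// ge_min lexx orbT.
have [r r0 hr] := gS_cont nE e0; have [s s0 hs] := gT_cont nE e0.
have rs : 0 < Num.min r s by rewrite lt_min r0.
have [n [k]] := orbit_dense x0 x irr rs; rewrite lt_min => /andP[yr ys].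
have nEy := nE_orb (n := n) (k := k) nE0.
have [z1 hz1] := transfer_orbit E_inv bS gS_per gS_coc n k nE0.
have [z2 hz2] := transfer_orbit E_inv bT gT_per gT_coc n k nE0.
have := hr _ nEy yr; have := hs _ nEy ys; rewrite hz1 hz2 !ltr_norml => /andP[a1 a2] /andP[b1 b2].
have h1 : (Num.floor f)%:~R < (z2 - z1)%:~R :> R by rewrite intrB; rewrite /f in e1 e2 *; lra.
have h2 : (z2 - z1)%:~R < (Num.floor f + 1)%:~R :> R.
  by rewrite intrB intrD; rewrite /f in e1 e2 *; lra.
by move: h1 h2; rewrite !ltr_int ltzD1 leNgt => ->.
Qed.

Let locS x : ~ E x -> exists2 r, 0 < r & forall y, `|y - x| < r -> hits S y = hits S x.
Proof. exact: (hits_locally_constant_off E_inv bS ES). Qed.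

Let locT x : ~ E x -> exists2 r, 0 < r & forall y, `|y - x| < r -> hits T y = hits T x.
Proof. exact: (hits_locally_constant_off E_inv bT ET). Qed.

Let hits0 (A : set V) x y : hits A x = hits A y -> A x -> A y.
Proof.
move=> h Ax; have : hits A x 0 by rewrite /hits /= int_vec0 addr0.
by rewrite h /hits /= int_vec0 addr0.
Qed.

Local Notation label := (int * 'rV[int]_d.+1)%type.
Let sh (z : label) : V := orb z.1 z.2.

Section with_offset.
Variable c : R.
Hypothesis gST : forall x, ~ E x -> exists z : int, gT x - gS x + c = z%:~R.

(** Equality of the rank of y in S and of the rank of y + sh z in T, with times
    counted from y. *)
Let matched (y : V) (z : label) : Prop := [/\ S y, T (y + sh z) &
  (idx alpha S y)%:R - gS y + c =
  (idx alpha T (y + sh z))%:R + z.1%:~R * mu - gT (y + sh z)].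

Let matched_exists y : ~ E y -> S y -> exists z, matched y z.
Proof.
move=> nE Sy; have [e he] := gST nE.
have [|z [[Tz vz] _]] := rank_bijection irr E_inv bT mu0 gT_per gT_bnd gT_coc
  (v := (idx alpha S y)%:R - gS y + c) (z := (idx alpha S y)%:Z + e) nE.
  by rewrite intrD -he -pmulrn; ring.
by exists z; split.
Qed.

Let matched_unique y z z' : ~ E y -> matched y z -> matched y z' -> z = z'.
Proof.
move=> nE [Sy Tz vz] [_ Tz' vz']; have [e he] := gST nE.
have [|w [_ uw]] := rank_bijection irr E_inv bT mu0 gT_per gT_bnd gT_coc
  (v := (idx alpha S y)%:R - gS y + c) (z := (idx alpha S y)%:Z + e) nE.
  by rewrite intrD -he -pmulrn; ring.
by rewrite -(uw z) ?(uw z')//; split.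
Qed.

Let sourceE (z : label) y : (y - sh z) = y + orb (- z.1) (- z.2).
Proof. by rewrite /sh mulrNz int_vecN opprD. Qed.

Let target_rank y : ~ E y -> exists z : int,
  (idx alpha T y)%:R - gT y - c + gS y = z%:~R.
Proof.
move=> nE; have [e he] := gST nE; exists ((idx alpha T y)%:Z - e).
by rewrite intrB -he -pmulrn; ring.
Qed.

Let target_exists y : ~ E y -> T y -> exists z, matched (y - sh z) z.
Proof.
move=> nE Ty; have [e he] := target_rank nE.
have [[n k] [[/= Sz vz] _]] := rank_bijection irr E_inv bS mu0 gS_per gS_bnd gS_coc nE he.
exists (- n, - k); rewrite /matched subrK sourceE /= !opprK; split=> //.
by rewrite intrN mulNr; lra.
Qed.

Let target_unique y z z' : ~ E y ->
  matched (y - sh z) z -> matched (y - sh z') z' -> z = z'.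
Proof.
rewrite /matched !subrK !sourceE => nE [Sz _ vz] [Sz' _ vz'].
have [e he] := target_rank nE.
have [w [_ uw]] := rank_bijection irr E_inv bS mu0 gS_per gS_bnd gS_coc nE he.
have h1 : w = (- z.1, - z.2) by apply: uw; split=> //=; rewrite intrN mulNr; lra.
have h2 : w = (- z'.1, - z'.2) by apply: uw; split=> //=; rewrite intrN mulNr; lra.
case: z z' h1 h2 {Sz Sz' vz vz'} => [n k] [n' k'] /= -> [] /oppr_inj -> /oppr_inj ->.
by [].
Qed.

(** The two ranks differ by an integer at every point off E, and this integer
    depends continuously on the point. *)
Let matched_near y z : ~ E y -> matched y z -> exists2 r, 0 < r &
  forall w, `|w - y| < r -> ~ E w -> matched w z.
Proof.
move=> nE [Sy Tz vz]; have nEz : ~ E (y + sh z) by exact: nE_orb.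
have [r1 r10 h1] := locS nE; have [r2 r20 h2] := locT nEz.
have half : 0 < 2^-1 :> R by rewrite invr_gt0.
have [r3 r30 h3] := gS_cont nE half; have [r4 r40 h4] := gT_cont nEz half.
exists (Num.min (Num.min r1 r2) (Num.min r3 r4)); first by rewrite !lt_min r10 r20 r30.
move=> w; rewrite !lt_min => /andP[/andP[w1 w2] /andP[w3 w4]] nEw.
have shw : w + sh z - (y + sh z) = w - y by rewrite opprD addrACA subrr addr0.
have nEwz : ~ E (w + sh z) by exact: nE_orb.
have e1 := h1 w w1; have e2 : hits T (w + sh z) = hits T (y + sh z) by apply: h2; rewrite shw.
split; [exact: hits0 (esym e1) Sy|exact: hits0 (esym e2) Tz|].
rewrite (eq_idx _ e1) (eq_idx _ e2).
have [a ha] := gST nE; have [a' ha'] := gST nEw.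
have [b hb] := transfer_orbit E_inv bT gT_per gT_coc z.1 z.2 nE.
have [b' hb'] := transfer_orbit E_inv bT gT_per gT_coc z.1 z.2 nEw.
have := h3 w nEw w3; have := h4 _ nEwz; rewrite shw => /(_ w4).
rewrite -/(sh z) in hb hb'; rewrite !ltr_norml => /andP[k1 k2] /andP[k3 k4].
have : a' + b' - (a + b) = 0.
  apply: (@intr_eq0_lt1 R); rewrite ltr_norml intrB !intrD -ha -ha'.
  by apply/andP; split; lra.
move=> /(congr1 (fun i : int => i%:~R : R)); rewrite intrB !intrD -ha -ha' => e.
by move: vz hb hb' e; lra.
Qed.

(** The time z.1 is bounded because all other terms of the equality of ranks are;
    the vector z.2 is bounded because S and T are. *)
Let finite_labels : exists zs : seq label, uniq zs /\
  forall y z, ~ E y -> matched y z -> z \in zs.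
Proof.
have [KS KS0 SK] := (bounded_setP _).1 bS; have [KT KT0 TK] := (bounded_setP _).1 bT.
have [MS MS0 MSle] := chi_le bS; have [MT MT0 MTle] := chi_le bT.
pose B := Num.truncn ((MS + MT + C + C + `|c|) / mu).
pose A := [set n : int | (`|n| <= B)%N] `*`
  [set k : 'rV[int]_d.+1 | `|0 + iv k| <= KS + KT + B%:R * `|alpha|].
have fA : finite_set A.
  by apply: finite_setX; [exact: finite_int_interval|exact: finite_window].
exists (fset_set A); split; first exact: fset_uniq.
move=> y [n k] nE [Sy Tz vz]; have nEz : ~ E (y + sh (n, k)) by exact: nE_orb.
have idx_le (D : set V) M x : bounded_set D -> (forall x, chi D x <= M) -> D x ->
    (idx alpha D x)%:R <= M.
  move=> bD DM Dx; have [h _] := slice_rank irr x bD.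
  have := h 0; rewrite int_vec0 addr0 => /(_ _)/ltW/le_trans; apply; last exact: DM.
  by rewrite /hits /= int_vec0 addr0.
have i1 := idx_le S MS y bS MSle Sy; have i2 := idx_le T MT _ bT MTle Tz.
have i3 : 0 <= (idx alpha S y)%:R :> R by [].
have i4 : 0 <= (idx alpha T (y + sh (n, k)))%:R :> R by [].
have := gS_bnd nE; have := gT_bnd nEz; rewrite !ler_norml => /andP[b1 b2] /andP[b3 b4].
have c1 := ler_norm c; have c2 := ler_norm (- c); rewrite normrN in c2.
have nB : (`|n| <= B)%N.
  rewrite -ltnS -(ltr_nat R); apply: le_lt_trans (truncnS_gt _).
  rewrite ler_pdivlMr// natr_absz intr_norm -[X in _ * X]gtr0_norm// -normrM.
  rewrite ler_norml /=; move: vz => /= vz; apply/andP; split; lra.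
rewrite in_fset_set//; apply/mem_set; split=> //=.
rewrite add0r (_ : iv k = (y + sh (n, k)) - y - alpha *~ n); last first.
  by rewrite /sh /= [y + _]addrC addrK addrAC subrr add0r.
apply: le_trans (ler_normB _ _) _; apply: lerD.
  by apply: le_trans (ler_normB _ _) _; rewrite addrC; apply: lerD; [exact: SK|exact: TK].
rewrite -scaler_int normrZ ler_wpM2r//.
by rewrite -intr_norm -natr_absz ler_nat.
Qed.

(** The piece of y is given by the first label z that is matched with all points
    off E near y. As this label is locally constant off E on the interior of S, the
    boundaries of the pieces lie in E; points without a label form the last
    piece. *)
Lemma equidecomposable_with_offset : equidecomposable (shift_group alpha) S T.
Proof.
have [zs [uzs zsP]] := finite_labels.
pose near y z := exists2 r, 0 < r & forall w, `|w - y| < r -> ~ E w -> matched w z.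
pose lab y := find (fun z => `[< near y z >]) zs.
have lab_max y : (lab y < (size zs).+1)%N by rewrite ltnS find_size.
have near_unique y z z' : near y z -> near y z' -> z = z'.
  move=> [r r0 h] [r' r'0 h'].
  have rr' : 0 < Num.min r r' by rewrite lt_min r0.
  have [w nEw] := null_complement_dense y E_null rr'.
  by rewrite lt_min => /andP[wr wr']; apply: (matched_unique nEw); [exact: h|exact: h'].
have labE y z : z \in zs -> near y z -> lab y = index z zs.
  move=> zz nz; rewrite /lab /index; apply: eq_in_find => z' _ /=.
  by apply/asboolP/eqP => [nz'|->//]; exact: near_unique nz' nz.
have off_lab y z : ~ E y -> matched y z -> lab y = index z zs /\ (index z zs < size zs)%N.
  move=> nE m; have zz := zsP y z nE m; split; last by rewrite index_mem.
  by apply: labE => //; exact: matched_near.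
have lab_const y : ~ E y -> S y -> exists2 r, 0 < r & forall w, `|w - y| < r -> lab w = lab y.
  move=> nE Sy; have [z m] := matched_exists nE Sy.
  have [r r0 hr] := matched_near nE m.
  have zz := zsP y z nE m; exists (r / 2); first by rewrite divr_gt0.
  move=> w wr; rewrite !(labE _ z)//; first by exists r.
  exists (r / 2); first by rewrite divr_gt0.
  move=> w' w'r; apply: hr; rewrite -(subrK w w') -addrA (splitr r).
  by apply: le_lt_trans (ler_normD _ _) _; exact: ltrD.
pose P (j : 'I_(size zs).+1) := S `&` [set y | lab y = j].
pose g (j : 'I_(size zs).+1) := sh (nth (0, 0) zs j).
pose gg (j : 'I_(size zs).+1) := if (j < size zs)%N then g j else 0.
have P_target j y : ~ E y -> translate (gg j) (P j) y -> exists z,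
    [/\ matched (y - sh z) z, z \in zs & j = index z zs :> nat].
  move=> nE /translateE[Sy /= lj].
  have nE' : ~ E (y - gg j).
    rewrite /gg; case: ifP => _; last by rewrite subr0.
    by rewrite /g sourceE; exact: nE_orb.
  have [z m] := matched_exists nE' Sy; have [l1 l2] := off_lab _ _ nE' m.
  rewrite l1 in lj; exists z; have zz : z \in zs by rewrite -index_mem.
  by split=> //; move: m; rewrite /gg -lj l2 /g -lj nth_index.
exists (size zs).+1, P, gg; split.
- move=> j; split.
    by apply/bounded_setP; have [K K0 SK] := (bounded_setP _).1 bS; exists K => // y [/SK].
  apply: (null_subset _ E_null) => y [cP iP]; apply: contrapT => nE.
  have cS : closure S y by apply: closureS cP => ? [].
  have /nbhs_normP[r r0 rS] : interior S y.
    by apply: contrapT => iS; exact: (ES nE).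
  have Sy : S y by apply: rS; rewrite subrr normr0.
  have [s s0 hs] := lab_const y nE Sy.
  have [w [Sw /= lw] ws] := (closureP _ _).1 cP s s0.
  apply: iP; apply/nbhs_normP; exists (Num.min r s); first by rewrite lt_min r0.
  move=> w'; rewrite lt_min => /andP[w'r w's]; split; first exact: rS.
  by rewrite /= hs// -(hs w ws).
- split.
    apply/trivIsetP => i j _ _; apply: contraNeq => /set0P[y [[_ /= li] [_ /= lj]]].
    by apply/eqP/val_inj; rewrite /= -li -lj.
  apply/seteqP; split=> [y [j _ []]//|y Sy].
  by exists (Ordinal (lab_max y)).
- move=> j; rewrite /gg; case: ifP => _.
    by exists (nth (0, 0) zs j).1, (nth (0, 0) zs j).2.
  by exists 0, 0; rewrite mulr0z int_vec0 addr0.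
- move=> i j ij; apply: (null_subset _ E_null) => y [Pi Pj]; apply: contrapT => nE.
  have [z [mz zz iz]] := P_target i y nE Pi; have [z' [mz' zz' jz]] := P_target j y nE Pj.
  by move/eqP: ij; apply; apply/val_inj; rewrite /= iz jz (target_unique nE mz mz').
apply: (null_subset _ E_null) => y Dy; apply: contrapT => nE.
case: Dy => -[]; last first.
  move=> Ty nU; have [z m] := target_exists nE Ty; apply: nU.
  have nE' : ~ E (y - sh z) by rewrite sourceE; exact: nE_orb.
  have [l1 l2] := off_lab _ _ nE' m.
  exists (Ordinal (ltnW l2 : (index z zs < (size zs).+1)%N)) => //.
  apply/translateE; rewrite /gg /= l2 /g /= nth_index; last by rewrite -index_mem.
  by split=> //; case: m.
move=> [j _ Pj] nT; apply: nT; have [z [[_ + _] _ _]] := P_target j y nE Pj.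
by rewrite subrK.
Qed.

End with_offset.

Theorem equal_density_equidecomposable : equidecomposable (shift_group alpha) S T.
Proof. by have [c hc] := difference_integral; apply: (@equidecomposable_with_offset c). Qed.

End matching.

(** * The characterization *)

Section hull.
Context (R : realType) (d : nat) (alpha : 'rV[R]_d.+1).
Local Notation V := 'rV[R]_d.+1.
Local Notation leb := (@lebesgue_outer R d).
Implicit Types (F : set V).

Definition orbit_hull F : set V :=
  [set x | exists n k, F (x + (alpha *~ n + int_vec R k))].

Lemma orbit_hull_invariant F : orbit_invariant alpha (orbit_hull F).
Proof.
move=> x n k [n' [k' h]]; exists (n' - n), (k' - k).
rewrite mulrzBr int_vecD int_vecN -addrA addrACA.
by rewrite [alpha *~ n + _]addrC [X in _ + (_ + X)]addrC !subrK.
Qed.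

Lemma subset_orbit_hull F : F `<=` orbit_hull F.
Proof. by move=> x Fx; exists 0, 0; rewrite mulr0z int_vec0 !addr0. Qed.

Lemma orbit_hull_null F : leb F = 0%E -> leb (orbit_hull F) = 0%E.
Proof.
move=> F0; apply: (@null_subset _ _ _ (\bigcup_(z : int * 'rV[int]_d.+1)
    translate (- (alpha *~ z.1 + int_vec R z.2)) F)).
  by move=> x [n [k Fx]]; exists (n, k) => //; apply/translateE; rewrite opprK.
by apply: null_bigcup => z; rewrite lebesgue_outer_translate.
Qed.

End hull.

Section characterization.
Context (R : realType) (d : nat) (alpha : 'rV[R]_d.+1).
Local Notation V := 'rV[R]_d.+1.
Local Notation iv := (@int_vec R d.+1).
Local Notation leb := (@lebesgue_outer R d).

Lemma indic_partition n (A : 'I_n -> set V) (T : set V) y :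
  (forall i j, i != j -> A i y -> A j y -> False) ->
  (T y <-> exists i, A i y) -> (\1_T y : R) = \sum_i \1_(A i) y.
Proof.
move=> dis TA; have [[i Ai]|nA] := pselect (exists i, A i y).
  rewrite (bigD1 i)//= big1 ?addr0; last first.
    by move=> j ji; rewrite indicE memNset// => Aj; exact: (dis j i).
  by rewrite !indicE !mem_set//; apply/TA; exists i.
rewrite big1; first by rewrite indicE memNset// => /TA.
by move=> i _; rewrite indicE memNset// => Ai; apply: nA; exists i.
Qed.

(** The exceptional null set is the union of the translates by G of the points
    where the translated pieces overlap or fail to partition T. Off it, [chi S] and
    [chi T] are sums over the same pieces up to translations by G. *)
Lemma equidecomposable_discrepancy (S T : set V) (rho C : R) :
  bounded_set S -> bounded_set T ->
  equidecomposable (shift_group alpha) S T ->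
  (forall x n, `|birkhoff alpha (chi T) n x - n%:R * rho| <= C) ->
  exists E C', leb E = 0%E /\
    forall x n, ~ E x -> `|birkhoff alpha (chi S) n x - n%:R * rho| <= C'.
Proof.
move=> bS bT [N [P [g [rP [tP PS] gG gdis gT]]]] hT.
pose A j := translate (g j) (P j).
pose F := (\bigcup_(ij : 'I_N * 'I_N) if ij.1 == ij.2 then set0 else A ij.1 `&` A ij.2)
  `|` ((\bigcup_j A j) `+` T).
have F0 : leb F = 0%E.
  apply: null_setU => //; apply: null_bigcup => -[i j] /=.
  by case: eqVneq => [_|ij]; [exact: outer_measure0|exact: gdis].
have [nn hn] := boolp.choice gG; have [kk gE] := boolp.choice hn => {hn}.
have bP j : bounded_set (P j) by have [] := rP j.
have /boolp.choice[K hK] : forall j, exists K, 0 < K /\ forall y, P j y -> `|y| <= K.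
  by move=> j; have [K K0 h] := (bounded_setP _).1 (bP j); exists K.
have /boolp.choice[M hM] : forall j, exists M, 0 <= M /\ forall y, chi (P j) y <= M.
  by move=> j; have [M0 h0 h] := chi_le (bP j); exists M0.
pose KK := \sum_j (K j + `|g j|).
have KKj j : K j + `|g j| <= KK.
  rewrite /KK (bigD1 j)//= lerDl; apply: sumr_ge0 => i _.
  by rewrite addr_ge0// ltW//; have [] := hK i.
have chiS x : chi S x = \sum_j chi (P j) x.
  rewrite chiE (eq_bigr (fun j => periodize (\1_(P j)) x))//.
  rewrite -(@periodize_sum _ _ KK); last first.
    move=> j; apply: supported_indic => y /((hK j).2 y) h.
    by apply: le_trans (KKj j); apply: ler_wpDr.
  apply: eq_periodize => k; apply: indic_partition => [i j ij Pi Pj|].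
    by move/trivIsetP: tP => /(_ i j I I ij); apply/eqP/set0P; exists (x + iv k).
  by rewrite -PS; split=> [[j _ ?]|[j ?]]; exists j.
have chiT x : ~ orbit_hull alpha F x -> chi T x = \sum_j chi (P j) (x - g j).
  move=> nF; rewrite (eq_bigr (fun j => chi (A j) x)); last first.
    by move=> j _; rewrite chi_translate.
  rewrite chiE (eq_bigr (fun j => periodize (\1_(A j)) x))//.
  rewrite -(@periodize_sum _ _ KK); last first.
    move=> j; apply: supported_indic => _ [y /((hK j).2 y) h <-].
    by apply: le_trans (KKj j); apply: le_trans (ler_normD _ _) _; rewrite lerD2r.
  apply: eq_periodize => k.
  have nFk : ~ F (x + iv k).
    by move=> Fk; apply: nF; exists 0, k; rewrite mulr0z add0r.
  apply: indic_partition => [i j ij Ai Aj|].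
    by apply: nFk; left; exists (i, j) => //=; rewrite (negbTE ij).
  split=> [Tk|[j Aj]].
    apply: contrapT => nA; apply: nFk; right; right; split=> // -[j _ Aj].
    by apply: nA; exists j.
  by apply: contrapT => nT; apply: nFk; right; left; split=> //; exists j.
exists (orbit_hull alpha F), (C + \sum_j (absz (nn j))%:R * M j); split.
  exact: orbit_hull_null.
move=> x n nE.
have ST : birkhoff alpha (chi T) n x - birkhoff alpha (chi S) n x =
   \sum_j (birkhoff alpha (chi (P j)) n (x - g j) - birkhoff alpha (chi (P j)) n x).
  rewrite /birkhoff sumrB [X in _ = X - _]exchange_big [X in _ = _ - X]exchange_big /=.
  congr (_ - _); apply: eq_bigr => k _; last exact: chiS.
  rewrite chiT; first by apply: eq_bigr => j _; rewrite addrAC.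
  have := orbit_invariantN (n := k%:Z) (m := 0) (@orbit_hull_invariant _ _ alpha F) nE.
  by rewrite int_vec0 addr0.
have h : `|birkhoff alpha (chi T) n x - birkhoff alpha (chi S) n x| <=
    \sum_j (absz (nn j))%:R * M j.
  rewrite ST; apply: le_trans (ler_norm_sum _ _ _) _; apply: ler_sum => j _.
  apply: birkhoff_shift_le (gE j); first exact: chi_int_periodic.
  by move=> y; rewrite chi_ge0 (hM j).2.
rewrite (_ : _ - _ = (birkhoff alpha (chi T) n x - n%:R * rho) -
   (birkhoff alpha (chi T) n x - birkhoff alpha (chi S) n x)); last ring.
by apply: le_trans (ler_normB _ _) _; exact: lerD.
Qed.

Lemma equidecomposable_bounded_remainder (S : set V) (v : (d.+1).-tuple V) :
  riemann_measurable S -> free v -> (forall k, shift_group alpha (tnth v k)) ->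
  equidecomposable (shift_group alpha) S (parallelepiped v) ->
  bounded_remainder_set alpha S.
Proof.
move=> rS fv vG SP; have mS := riemann_lebesgue_measurable rS; have [bS _] := rS.
have [rho [C hP]] := parallelepiped_discrepancy fv vG.
have [E [C' [E0 hS]]] :=
  equidecomposable_discrepancy bS (bounded_parallelepiped v) SP hP.
have rhoE := bounded_discrepancy_mes bS mS E0 hS.
split=> //; exists C' => n _; exists E; split=> //.
  exact: null_lebesgue_measurable.
move=> x /= nP; apply: contrapT => nE; apply: nP => _.
by rewrite rhoE; exact: hS.
Qed.

(** Near x, a Birkhoff sum of given length is constant. So its estimate at almost
    every point of the unit cell, and by periodicity at almost every point, holds
    at x. *)
Lemma bounded_remainder_everywhere (S E : set V) :
  orbit_invariant alpha E -> leb E = 0%E ->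
  (forall x, ~ E x -> ~ boundary S x) -> bounded_remainder_set alpha S ->
  exists C, forall x n, ~ E x -> `|birkhoff alpha (chi S) n x - n%:R * mes S| <= C.
Proof.
move=> E_inv E0 ES [bS _ [C hC]].
exists (Num.max C 0) => x n nE.
case: n => [|n]; first by rewrite /birkhoff big_geq// mul0r subrr normr0 le_max lexx orbT.
have [Z [mZ Z0 hZ]] := hC n.+1 isT.
have loc := chi_locally_constant_off E_inv bS ES.
have [r r0 hr] := locally_constant_birkhoff E_inv loc n.+1 nE.
have Z0' : leb (\bigcup_(m : 'rV[int]_d.+1) translate (iv m) Z) = 0%E.
  by apply: null_bigcup => m; rewrite lebesgue_outer_translate.
have [y nZ yx] := null_complement_dense x Z0' r0.
rewrite -(hr y yx) le_max; apply/orP; left.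
pose m : 'rV[int]_d.+1 := \row_i - Num.floor (y 0 i).
have -> : birkhoff alpha (chi S) n.+1 y = birkhoff alpha (chi S) n.+1 (y + iv m).
  by apply: eq_bigr => k _; rewrite addrAC chi_int_periodic.
apply: contrapT => nle; apply: nZ; exists (- m) => //; apply/translateE.
rewrite int_vecN opprK; apply: hZ => /= h; apply: nle; apply: h => i.
rewrite !mxE intrN; have := floor_le (y 0 i); have := floorD1_gt (y 0 i).
by rewrite intrD => ? ?; apply/andP; split; lra.
Qed.

Lemma bounded_remainder_equidecomposable (S : set V) :
  irrational_vector alpha -> riemann_measurable S -> (0 < leb S)%E ->
  bounded_remainder_set alpha S ->
  exists v : (d.+1).-tuple V,
    [/\ free v, forall k, shift_group alpha (tnth v k) &
        equidecomposable (shift_group alpha) S (parallelepiped v)].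
Proof.
move=> irr [bS S0] Spos brs; set mu := mes S.
have mu0 : 0 < mu.
  by rewrite /mu /mes fine_gt0// Spos/=; exact: bounded_lebesgue_outer.
have transfer (A E : set V) (C : R) : bounded_set A -> orbit_invariant alpha E ->
    (forall x, ~ E x -> ~ boundary A x) ->
    (forall x n, ~ E x -> `|birkhoff alpha (chi A) n x - n%:R * mu| <= C) ->
    exists g, [/\ int_periodic g, forall x, ~ E x -> `|g x| <= C,
      forall x, ~ E x -> g (x + alpha) = g x - (chi A x - mu) & continuous_off E g].
  move=> bA E_inv EA hA; apply: transfer_function => //.
  - by move=> x m; rewrite chi_int_periodic.
  - move=> x n nE; have := hA x n nE; congr (`|_| <= _).
    by rewrite /birkhoff sumrB sumr_const_nat subn0 mulr_natl.
  move=> y /(chi_locally_constant_off E_inv bA EA)[r r0 hr].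
  by exists r => // w /hr ->.
have [p0 [p muE]] : exists (p0 : int) (p : 'I_d.+1 -> int),
    mu = p0%:~R + \sum_i (p i)%:~R * alpha 0 i.
  pose E := orbit_hull alpha (boundary S).
  have E_inv : orbit_invariant alpha E by exact: orbit_hull_invariant.
  have E0 : leb E = 0%E by exact: orbit_hull_null.
  have ES x : ~ E x -> ~ boundary S x by move=> nE /subset_orbit_hull - /(_ alpha).
  have [C hC] := bounded_remainder_everywhere E_inv E0 ES brs.
  have [g [g_per g_bnd g_coc g_cont]] := transfer S E C bS E_inv ES hC.
  have [x0 nE0 _] := null_complement_dense 0 E0 (@ltr01 R).
  apply: return_times_module => // e e0.
  have [r r0 hr] := g_cont x0 e nE0 e0; exists r => // n k nk.
  have [z hz] := transfer_orbit E_inv bS g_per g_coc n k nE0.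
  exists (- z); have := hr (x0 + (alpha *~ n + iv k)) (orbit_invariantN E_inv nE0).
  rewrite addrAC subrr add0r => /(_ nk); congr (`|_| < _).
  by rewrite hz intrN; ring.
have [v [fv vG [C' hP]]] := parallelepiped_of_density mu0 muE.
exists v; split=> //; set P := parallelepiped v.
have bP : bounded_set P by exact: bounded_parallelepiped.
pose E := orbit_hull alpha (boundary S `|` boundary P).
have E_inv : orbit_invariant alpha E by exact: orbit_hull_invariant.
have E0 : leb E = 0%E.
  by apply: orbit_hull_null; apply: null_setU => //; exact: parallelepiped_boundary_null.
have ES x : ~ E x -> ~ boundary S x.
  by move=> nE bx; apply: nE; apply: subset_orbit_hull; left.
have EP x : ~ E x -> ~ boundary P x.
  by move=> nE bx; apply: nE; apply: subset_orbit_hull; right.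
have [C hC] := bounded_remainder_everywhere E_inv E0 ES brs.
pose D := Num.max C C'.
have [|g [? ? ? ?]] := transfer S E D bS E_inv ES.
  by move=> x n nE; rewrite le_max hC.
have [|h [? ? ? ?]] := transfer P E D bP E_inv EP.
  by move=> x n nE; rewrite le_max hP orbT.
exact: (@equal_density_equidecomposable _ _ _ E S P mu D irr E_inv E0 mu0 bS bP ES EP g h).
Qed.

End characterization.

Theorem corollary3 (R : realType) (d : nat) (alpha : 'rV[R]_d.+1)
    (S : set 'rV[R]_d.+1)
    (alpha_irr : irrational_vector alpha)
    (S_riemann : riemann_measurable S)
    (S_pos : (0 < lebesgue_rV S)%E) :
  bounded_remainder_set alpha S <->
  exists v : (d.+1).-tuple 'rV[R]_d.+1,
    [/\ free v,
        forall k, shift_group alpha (tnth v k) &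
        equidecomposable (shift_group alpha) S (parallelepiped v)].
Proof.
split; first exact: bounded_remainder_equidecomposable.
by move=> [v [fv vG SP]]; exact: equidecomposable_bounded_remainder fv vG SP.
Qed.
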